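(* Let $\mathbb D\subset\mathbb C$ be the open unit disc, and for $\lambda\in\mathbb D$ let $f_0=f_{0,\lambda}$ and $f_1=f_{1,\lambda}$ be rational functions on $\widehat{\mathbb C}$ depending analytically on $\lambda$. Let $p_0,p_1\in(0,1)$ with $p_0+p_1=1$. Assume that for every $\lambda\in\mathbb D$: (a) $0$ is a fixed point of both $f_0$ and $f_1$; writing $\mu(\lambda)=f_{0,\lambda}'(0)$ and $\nu(\lambda)=f_{1,\lambda}'(0)$, one has $|\mu(\lambda)|>1$ and $|\nu(\lambda)|<1$; (b) $\infty$ is a superattracting fixed point of $f_0$, the local degree of $f_0$ at $\infty$ being $d\ge 2$, and $f_1(\infty)=0$; (c) $f_0$ is hyperbolic, and every attracting fixed or periodic point of $f_0$ other than $\infty$ is mapped into the immediate basin of $\infty$ for $f_0$ by some iterate $f_1^k$; (d) $p_0\ln|\mu(\lambda)|+p_1\ln|\nu(\lambda)|>0$ (with $\ln 0=-\infty$). Fix $\lambda\in\mathbb D$ such that, in addition: (e) $\overline{\{\mu(\lambda)^n\nu(\lambda)^m : n,m\in\mathbb N\}}=\mathbb C$; (f) no attracting fixed or periodic point of $f_0$ is mapped exactly to $\infty$ by an iterate $f_1^k$, $k\ge 1$; (g) for every $z_0\in\widehat{\mathbb C}\setminus\{0,\infty\}$ there is an element $g$ of the semigroup $G_\lambda=\langle f_0,f_1\rangle$ such that $g(z_0)$ lies in the immediate basin of attraction of $\infty$ for $f_0$. Assume moreover that $p_0>\frac1d$. Then the delta measure $\delta_0$ is the only stationary probability measure of the iterated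 function system $\langle f_0,f_1\rangle$ with probabilities $p_0,p_1$. Moreover, for any $\varepsilon>0$ and for Lebesgue almost every $z\in\widehat{\mathbb C}$, the following hold for $\nu_{p_0,p_1}$-almost all $\omega\in\Sigma$: (1) $f^n_\omega(z)\notin B(0,\varepsilon)$ for infinitely many $n$; (2) $\lim_{N\to\infty}\frac1N\left|\{0\le n<N : f^n_\omega(z)\in B(0,\varepsilon)\}\right|=1$.
   Context: $\widehat{\mathbb C}$ is the Riemann sphere and $B(0,\varepsilon)=\{z\in\mathbb C:|z|<\varepsilon\}$. $\langle f_0,f_1\rangle$ denotes both the semigroup of compositions of $f_0$ and $f_1$ and the iterated function system in which at each step $f_0$ or $f_1$ is chosen at random, i.i.d., with probabilities $p_0$, $p_1$. A Borel measure $m$ on $\widehat{\mathbb C}$ is stationary if $m=p_0\,f_0m+p_1\,f_1m$, where $f_im(A)=m(f_i^{-1}(A))$ is the push-forward. $\Sigma=\{0,1\}^{\mathbb N}$ (indices starting at $0$) carries the product topology and Borel $\sigma$-algebra; $\nu_{p_0,p_1}$ is the Bernoulli measure on $\Sigma$ with probabilities $p_0,p_1$ of the symbols $0,1$ (not to be confused with the multiplier $\nu(\lambda)$). For $\omega=(\omega_i)_{i\ge0}\in\Sigma$, $f^n_\omega(z)=f_{\omega_{n-1}}\circ\cdots\circ f_{\omega_0}(z)$. A rational map (of degree at least $2$) is hyperbolic if each of its critical points converges under iteration to an attracting (possibly superattracting) periodic cycle. The immediate basin of $\infty$ for $f_0$ is the connected component containing $\infty$ of the basin of attraction of $\infty$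 under $f_0$. *)

(* Defs.v *)
From HB Require Import structures.
From mathcomp Require Import all_boot all_order all_algebra.
From mathcomp Require Import all_classical all_reals all_analysis.
From mathcomp Require Import complex.

Set Implicit Arguments.
Unset Strict Implicit.
Unset Printing Implicit Defensive.

Import Order.TTheory GRing.Theory Num.Theory.
Import numFieldNormedType.Exports.

Local Open Scope classical_set_scope.
Local Open Scope ring_scope.
Local Open Scope complex_scope.

(* R[i] with the topology of its modulus. *)
HB.instance Definition _ (R : realType) := GRing.ComAlgebra.copy R[i] R[i]^o.
HB.instance Definition _ (R : realType) := Vector.copy R[i] R[i]^o.
HB.instance Definition _ (R : realType) := NormedModule.copy R[i] R[i]^o.

Notation cmod := ComplexField.Normc.normc.

(* [Some z] is the finite point z, [None] is infinity. *)
Notation sphere R := (one_point_compactification R[i]).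

Definition borel (T : ptopologicalType) := g_sigma_algebraType (@open T).

Section Sphere.
Variable R : realType.
Local Notation C := R[i].
Local Notation S := (sphere R).
Implicit Types (f : S -> S) (z : S).

Definition infty : S := None.
Definition origin : S := Some 0.

Definition sphere_inv z : S :=
  if z is Some x then (if x == 0 then None else Some x^-1) else Some 0.

(* Meaningful on finite points only; [sphere_coord infty = 0] is the coordinate
   of infinity in the chart 1/z. *)
Definition sphere_coord z : C := if z is Some x then x else 0.

(* Both charts z and 1/z are involutions of the sphere, so [chart b] also serves
   as its own inverse. *)
Definition chart (at_infty : bool) : S -> S :=
  if at_infty then sphere_inv else id.

Definition sphere_ball (e : R) : set S :=
  [set z | exists2 x : C, z = Some x & cmod x < e].

Definition ratmap (p q : {poly C}) z : S :=
  match z with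
  | Some x => if q.[x] == 0 then None else Some (p.[x] / q.[x])
  | None => let n := (maxn (size p) (size q)).-1 in
            if q`_n == 0 then None else Some (p`_n / q`_n)
  end.

Definition rational_of_degree (n : nat) f : Prop :=
  exists p q : {poly C},
    [/\ coprimep p q, n = (maxn (size p) (size q)).-1 & f = ratmap p q].

Definition rational_map f : Prop := exists n, rational_of_degree n f.

(* (lambda, z) |-> f lambda z is holomorphic from (unit disc) x sphere to the
   sphere: in the charts z and 1/z of source and target it is complex
   differentiable as a function of two complex variables. *)
Definition analytic_family (f : C -> S -> S) : Prop :=
  forall (l0 z0 : C) (s t : bool), `|l0| < 1 ->
    chart t (f l0 (chart s (Some z0))) <> infty ->
    (\forall w \near ((l0, z0) : C * C),
       chart t (f w.1 (chart s (Some w.2))) <> infty) /\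
    differentiable
      (fun w : C * C => sphere_coord (chart t (f w.1 (chart s (Some w.2)))))
      ((l0, z0) : C * C).

(* f read in the chart z or 1/z around z and around f z; the point z itself
   corresponds to [sphere_coord z]. *)
Definition local_expr f z (y : C) : C :=
  sphere_coord (chart (~~ isSome (f z)) (f (chart (~~ isSome z) (Some y)))).

Definition sphere_deriv f z : C := derive1 (local_expr f z) (sphere_coord z).

(* F y - F x = (y - x)^k (c + o(1)) as y -> x, with c <> 0, where F is f in
   local coordinates and x the coordinate of z. *)
Definition has_local_degree f z (k : nat) : Prop :=
  exists2 c : C, c != 0 &
    let F := local_expr f z in
    let x := sphere_coord z in
    (F y - F x) / (y - x) ^+ k @[y --> x^'] --> c.

Definition critical_point f z : Prop := sphere_deriv f z = 0.

Definition superattracting_fixed f z : Prop := f z = z /\ sphere_deriv f z = 0.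

Definition attracting_of_period (n : nat) f z : Prop :=
  [/\ (0 < n)%N, iter n f z = z & `|sphere_deriv (iter n f) z| < 1].

Definition attracting_periodic f z : Prop :=
  exists n, attracting_of_period n f z.

Definition converges_to_attracting_cycle f z : Prop :=
  exists n a, attracting_of_period n f a /\
    iter (k * n)%N f z @[k --> \oo] --> a.

Definition hyperbolic f : Prop :=
  (exists2 n, (2 <= n)%N & rational_of_degree n f) /\
  forall c, critical_point f c -> converges_to_attracting_cycle f c.

Definition basin_infty f : set S := [set z | iter k f z @[k --> \oo] --> infty].

Definition immediate_basin_infty f : set S :=
  connected_component (basin_infty f) infty.

Inductive semigroup (f0 f1 : S -> S) : (S -> S) -> Prop :=
| semigroup0 : semigroup f0 f1 f0
| semigroup1 : semigroup f0 f1 f1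
| semigroup_comp g h :
    semigroup f0 f1 g -> semigroup f0 f1 h -> semigroup f0 f1 (g \o h).

(* The symbols 0 and 1 are [false] and [true]. *)
Fixpoint random_orbit (f0 f1 : S -> S) (w : cantor_space) (n : nat) z : S :=
  if n is m.+1
  then (if w m then f1 else f0) (random_orbit f0 f1 w m z)
  else z.

Definition stationary (p0 p1 : R) (f0 f1 : S -> S)
    (m : set (borel S) -> \bar R) : Prop :=
  forall A : set (borel S), measurable A ->
    m A = (p0%:E * pushforward m (f0 : borel S -> borel S) A +
           p1%:E * pushforward m (f1 : borel S -> borel S) A)%E.

(* The Bernoulli measure is the unique Borel probability measure with these
   values on cylinders. *)
Definition bernoulli_measure (p0 p1 : R)
    (nu : set (borel cantor_space) -> \bar R) : Prop :=
  forall (n : nat) (s : nat -> bool),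
    nu [set w : cantor_space | forall i, (i < n)%N -> w i = s i] =
    (\prod_(i < n) (if s i then p1 else p0))%:E.

(* Infinity is a null point and stereographic projection preserves null sets,
   so planar and spherical Lebesgue measure have the same null sets. *)
Definition sphere_ae (P : S -> Prop) : Prop :=
  {ae (@lebesgue_measure R \x @lebesgue_measure R)%E,
    forall xy : R * R, P (Some (xy.1 +i* xy.2))}.

Definition visits (f0 f1 : S -> S) (w : cantor_space) z (B : set S) (N : nat) :
    nat :=
  count (fun n => `[< B (random_orbit f0 f1 w n z) >]) (iota 0 N).

End Sphere.

(* Main.v *)
Require Import Defs.
From mathcomp Require Import all_boot all_order all_algebra finmap.
From mathcomp Require Import all_classical all_reals all_analysis.
From mathcomp Require Import measurable_realfun complex ring lra.
Import Order.TTheory GRing.Theory Num.Theory.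
Import numFieldNormedType.Exports.
Local Open Scope classical_set_scope.
Local Open Scope ring_scope.

Set Implicit Arguments.
Unset Strict Implicit.
Unset Printing Implicit Defensive.

(* Let P phi = p0 (phi o f0) + p1 (phi o f1). If g <= c + (P phi - phi) for some
   bounded phi, then the averages of g along almost every orbit, and its
   integral against any stationary probability, are at most c: the first by an
   exponential supermartingale bound and Borel-Cantelli, the second by iterating
   P. Both uniqueness and (2) thus reduce to finding such phi, with c > 0
   arbitrarily small, for the indicator of the complement of every ball
   B(0, eps).

   Near infinity let h = ln |z|, and near 0 let k = - ln |z|, both truncated at a
   level M. One step decreases k by at most a constant, and k(f1 z) is at least
   h(z) - O(1), so p1 h is at most a constant, independent of M, plus the
   coboundary P k - k; say h <= C + (P phi - phi). On the other hand f0
   multiplies ln |z| by about d near infinity and p0 d > 1, so h at level M is at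
   most 1/rho times P of h at level delta M with rho > 1, delta > 1; iterating,
   C becomes C / rho^n. Hence a neighbourhood of infinity is visited with
   frequency 0, and so is the complement of B(0, eps), which by compactness is
   sent into that neighbourhood by finitely many words. The expansion at 0 plays
   no role here.

   For (1), the points eventually mapped to 0 are countably many. Elsewhere,
   |z|^(-t) with t small is contracted in mean near 0, so almost every orbit
   leaves a small ball around 0, after which it goes beyond any given radius with
   probability bounded below; hence it cannot stay in B(0, eps) forever. *)

(** * Averages along random orbits *)

Section MarkovOperator.
Context {R : realType} {T : Type}.
Variables (f0 f1 : T -> T) (p0 p1 : R).
Hypotheses (p0_gt0 : 0 < p0) (p1_gt0 : 0 < p1) (p01 : p0 + p1 = 1).
Implicit Types (g h phi : T -> R) (K U : set T) (z : T) (c : R) (b : bool)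
  (s : seq bool).

Definition step b z := (if b then f1 else f0) z.

Definition run s z := foldl (fun x b => step b x) z s.

Definition transfer phi z := p0 * phi (f0 z) + p1 * phi (f1 z).

Definition ubounded phi := exists B, forall z, `|phi z| <= B.

(* The coboundary [transfer phi - phi] averages out along almost every orbit, so
   this is a certificate that the long-run averages of [g] are at most [c]. *)
Definition mean_le g c :=
  exists2 phi, ubounded phi & forall z, g z <= c + (transfer phi z - phi z).

Definition mean_le0 g := forall c, 0 < c -> mean_le g c.

Lemma ubounded_le g B : (forall z, 0 <= g z <= B) -> ubounded g.
Proof. by move=> gB; exists B => z; case/andP: (gB z) => g0 ?; rewrite ger0_norm. Qed.

Lemma mean_le_mono g h c c' : (forall z, g z <= h z) -> c' <= c ->
  mean_le h c' -> mean_le g c.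
Proof.
move=> gh cc [phi ? H]; exists phi => // z.
by rewrite (le_trans (gh z))// (le_trans (H z))// lerD2r.
Qed.

Lemma mean_leD g h c c' : mean_le g c -> mean_le h c' ->
  mean_le (fun z => g z + h z) (c + c').
Proof.
move=> [phi [B phiB] H] [phi' [B' phiB'] H']; exists (fun z => phi z + phi' z).
  by exists (B + B') => z; rewrite (le_trans (ler_normD _ _))// lerD.
by move=> z; have := H z; have := H' z; rewrite /transfer; lra.
Qed.

Lemma mean_leZ a g c : 0 <= a -> mean_le g c ->
  mean_le (fun z => a * g z) (a * c).
Proof.
move=> a0 [phi [B phiB] H]; exists (fun z => a * phi z).
  by exists (a * B) => z; rewrite normrM ger0_norm// ler_wpM2l.
by move=> z; have := ler_wpM2l a0 (H z); rewrite /transfer; lra.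
Qed.

(** The corrector [g + phi] works: the summand [g] contributes exactly [transfer g - g], and what
    remains is the certificate of [g]. *)
Lemma mean_le_transfer g c : ubounded g -> mean_le g c -> mean_le (transfer g) c.
Proof.
move=> [B gB] [phi [B' phiB'] H]; exists (fun z => g z + phi z).
  by exists (B + B') => z; rewrite (le_trans (ler_normD _ _))// lerD.
by move=> z; have := H z; rewrite /transfer; lra.
Qed.

Lemma mean_le0_mono g h : (forall z, g z <= h z) -> mean_le0 h -> mean_le0 g.
Proof. by move=> gh H c c0; apply: mean_le_mono gh (lexx c) (H c c0). Qed.

Lemma mean_le0D g h : mean_le0 g -> mean_le0 h ->
  mean_le0 (fun z => g z + h z).
Proof.
move=> Hg Hh c c0; rewrite -(divfK (_ : 2 != 0) c)//.
rewrite mulr_natr mulr2n; apply: mean_leD.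
  by apply: Hg; rewrite divr_gt0.
by apply: Hh; rewrite divr_gt0.
Qed.

Lemma mean_le0Z a g : 0 < a -> mean_le0 g -> mean_le0 (fun z => a * g z).
Proof.
move=> a0 Hg c c0; have -> : c = a * (c / a) by rewrite mulrC divfK ?gt_eqF.
by apply: mean_leZ (ltW a0) _; apply: Hg; rewrite divr_gt0.
Qed.

Lemma transfer_ge0 g z : (forall z, 0 <= g z) -> 0 <= transfer g z.
Proof. by move=> g0; rewrite addr_ge0// mulr_ge0// ltW. Qed.

(** Each branch has positive probability, so [g] after that step is at most a constant times
    [transfer g]. *)
Lemma mean_le0_step b g : (forall z, 0 <= g z) -> ubounded g -> mean_le0 g ->
  mean_le0 (fun z => g (step b z)).
Proof.
move=> g0 gB Hg; have a0 : 0 < if b then p1 else p0 by case: b.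
apply: (@mean_le0_mono _ (fun z => (if b then p1 else p0)^-1 * transfer g z)).
  move=> z; rewrite ler_pdivlMl// /transfer /step; case: b {a0}.
    by rewrite lerDr mulr_ge0// ltW.
  by rewrite lerDl mulr_ge0// ltW.
apply: mean_le0Z; first by rewrite invr_gt0.
by move=> c c0; apply: mean_le_transfer => //; exact: Hg.
Qed.

Lemma mean_le0_run s g : (forall z, 0 <= g z) -> ubounded g -> mean_le0 g ->
  mean_le0 (fun z => g (run s z)).
Proof.
elim: s g => [//|b s IH] g g0 gB Hg.
apply: (@mean_le0_step b (fun z => g (run s z))) => //; last exact: IH.
by case: gB => B gB; exists B => z.
Qed.

(** The indicator of [K] is at most the finite sum, over [ws], of the indicators of [U] at the end
    of the word. *)
Lemma mean_le0_cover K U (ws : seq (seq bool)) : mean_le0 \1_U ->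
  (forall z, K z -> exists2 s, s \in ws & U (run s z)) -> mean_le0 \1_K.
Proof.
move=> HU KU.
have i0 : forall z, 0 <= (\1_U z : R) by move=> z; rewrite indicE.
have iB : ubounded (\1_U : T -> R).
  by apply: (@ubounded_le _ 1) => z; rewrite indicE; case: (_ \in _); rewrite lexx ler01.
apply: (@mean_le0_mono _ (fun z => \sum_(s <- ws) \1_U (run s z))).
  move=> z; rewrite indicE; case: (boolP (z \in K)) => [|_]; last first.
    by apply: sumr_ge0.
  rewrite inE => /KU[s sw Us].
  rewrite (bigID (pred1 s))/= ler_wpDr//; first exact: sumr_ge0.
  rewrite (eq_bigr (fun=> 1)); last first.
    by move=> i /eqP ->; rewrite indicE mem_set.
  rewrite big_const_seq iter_addr_0 ler_nat -has_count.
  by apply/hasP; exists s => /=.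
elim: ws {KU} => [|s ws IH].
  move=> c c0; exists (fun=> 0); first by exists 0 => z; rewrite normr0.
  by move=> z; rewrite big_nil /transfer !mulr0 !addr0 subr0 addr0 ltW.
apply: (@mean_le0_mono _
  (fun z => \1_U (run s z) + \sum_(t <- ws) \1_U (run t z))).
  by move=> z; rewrite big_cons.
by apply: mean_le0D IH; apply: (@mean_le0_run s \1_U).
Qed.

(** The bound [C] must be uniform in the truncation level [M]: each use of the growth inequality
    replaces [M] by [delta * M] and gains a factor [rho^-1], so [n] uses give [rho^-n C] at the
    original level. *)
Lemma mean_le0_growth (sigma : R -> T -> R) (rho delta C : R) :
  1 < rho -> 0 <= delta ->
  (forall M z, 0 <= M -> 0 <= sigma M z <= M) ->
  (forall M, 0 <= M -> mean_le (sigma M) C) ->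
  (forall M z, 0 <= M -> rho * sigma M z <= transfer (sigma (delta * M)) z) ->
  forall M, 0 <= M -> mean_le0 (sigma M).
Proof.
move=> rho1 delta0 sM sC sP.
have rho0 : 0 < rho by rewrite (lt_trans ltr01).
have sn n : forall M, 0 <= M -> mean_le (sigma M) (rho^-1 ^+ n * C).
  elim: n => [|n IH] M M0; first by rewrite expr0 mul1r; exact: sC.
  rewrite exprS -mulrA.
  apply: (@mean_le_mono _ (fun z => rho^-1 * transfer (sigma (delta * M)) z) _ _
    _ (lexx _) (mean_leZ _ (mean_le_transfer _ (IH (delta * M) _)))).
  - by move=> z; rewrite ler_pdivlMl//; exact: sP.
  - by rewrite invr_ge0 ltW.
  - by apply: (@ubounded_le _ (delta * M)) => z; apply: sM; rewrite mulr_ge0.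
  - by rewrite mulr_ge0.
move=> M M0 c c0.
have : (rho^-1 ^+ n * C) @[n --> \oo] --> (0 * C).
  apply: cvgMl; apply: cvg_expr.
  by rewrite ger0_norm ?invr_ge0 1?ltW// invf_lt1.
rewrite mul0r => /cvgrPdist_le/(_ c c0)[n _ /(_ n)].
rewrite /= leqnn sub0r normrN => /(_ isT) nc.
apply: (mean_le_mono _ _ (sn n M M0)) => //.
exact: le_trans (ler_norm _) nc.
Qed.

(** The coboundaries telescope; the induction peels off the summand [i = 0] and applies [transfer]
    to the bound for the others. *)
Lemma iter_transfer_sum n g h c : (forall z, g z <= c + (transfer h z - h z)) ->
  forall z, \sum_(i < n) iter i transfer g z <=
     c *+ n + (iter n transfer h z - h z).
Proof.
move=> H; elim: n => [|n IH] z; first by rewrite big_ord0 mulr0n/= subrr addr0.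
rewrite big_ord_recl.
have -> : \sum_(i < n) iter (lift ord0 i) transfer g z =
    transfer (fun y => \sum_(i < n) iter i transfer g y) z.
  rewrite [RHS]/transfer !mulr_sumr -big_split/=; apply: eq_bigr => i _.
  by [].
have := lerD (ler_wpM2l (ltW p0_gt0) (IH (f0 z))) (ler_wpM2l (ltW p1_gt0) (IH (f1 z))).
have := H z; rewrite /transfer/= -/(transfer _) mulrS.
have -> : p1 = 1 - p0 by rewrite -p01 addrAC subrr add0r.
set A := \sum_(_ < _) _; set B := \sum_(_ < _) _.
move: (iter n transfer h (f0 z)) (iter n transfer h (f1 z)) (c *+ n) => a b e.
by rewrite /=; lra.
Qed.

(** The expectation of [F] over [n] independent letters. Recursion on the first letter makes it
    unfold in step with [transfer] and [run]. *)
Fixpoint word_mean n (F : seq bool -> R) : R :=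
  if n is m.+1 then p0 * word_mean m (fun s => F (false :: s)) +
                    p1 * word_mean m (fun s => F (true :: s))
  else F [::].

Lemma word_mean_le n F G : (forall s, size s = n -> F s <= G s) ->
  word_mean n F <= word_mean n G.
Proof.
elim: n F G => [|n IH] F G FG /=; first exact: FG.
by apply: lerD; (rewrite ler_pM2l//; apply: IH => s sn; apply: FG; rewrite /= sn).
Qed.

Lemma word_meanZ n a F : word_mean n (fun s => a * F s) = a * word_mean n F.
Proof.
elim: n F => [//|n IH] F /=; rewrite !IH mulrDr !mulrA.
by rewrite (mulrC p0) (mulrC p1).
Qed.

Lemma word_meanD n F G :
  word_mean n (fun s => F s + G s) = word_mean n F + word_mean n G.
Proof. by elim: n F G => [//|n IH] F G /=; rewrite !IH; ring. Qed.

Lemma norm_iter_transfer n phi B z : (forall y, `|phi y| <= B) ->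
  `|iter n transfer phi z| <= B.
Proof.
move=> phiB; elim: n z => [//|n IH] z /=; apply: le_trans (ler_normD _ _) _.
rewrite !normrM (gtr0_norm p0_gt0) (gtr0_norm p1_gt0) -[leRHS]mul1r -p01 mulrDl.
by rewrite lerD// ler_pM2l.
Qed.

Lemma word_mean_run n phi z :
  word_mean n (fun s => phi (run s z)) = iter n transfer phi z.
Proof.
elim: n z => [//|n IH] z /=; rewrite /transfer -!IH.
by congr (_ * _ + _ * _).
Qed.

(** * Large deviations of sums along orbits *)

Fixpoint orbit_sum g s z : R :=
  if s is b :: s' then g z + orbit_sum g s' (step b z) else 0.

(** Since [exp(-x) >= 1 - x], it suffices that [(1 - x)(1 + x + 2x^2) = 1 + x^2 (1 - 2x)] is at
    least 1. *)
Lemma expR_le_quadratic (x : R) : x <= 2^-1 -> expR x <= 1 + x + 2 * x ^+ 2.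
Proof.
move=> x2; have x1 : 0 < 1 - x by lra.
rewrite -(mulr1 (expR x)) -ler_pdivlMl ?expR_gt0// -expRN.
have := expR_ge1Dx (- x).
have y0 : 0 <= 1 + x + 2 * x ^+ 2 by nra.
move=> /(ler_wpM2r y0); apply: le_trans.
have : 0 <= x ^+ 2 * (1 - 2 * x) by rewrite mulr_ge0 ?sqr_ge0//; lra.
rewrite !expr2; nra.
Qed.

(* The summed functional, corrected by the coboundary, is an exponential
   supermartingale. *)
Lemma word_mean_expR g phi c t n z :
  (forall y, expR (t * (g y - c)) * transfer (fun x => expR (- t * phi x)) y <=
     expR (- t * phi y)) ->
  word_mean n (fun s => expR (t * (orbit_sum g s z - c * (size s)%:R) -
                             t * phi (run s z))) <= expR (- t * phi z).
Proof.
move=> H; elim: n z => [|n IH] z /=.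
  by rewrite mulr0 subrr mulr0 sub0r mulNr.
apply: le_trans (H z).
rewrite /transfer mulrDr 2![expR _ * (_ * expR _)]mulrCA.
apply: lerD; (rewrite ler_pM2l//; apply: le_trans (ler_wpM2l (expR_ge0 _) (IH _));
  rewrite -word_meanZ; apply: word_mean_le => s sn; rewrite -expRD ler_expR
  /= -natr1 /run; lra).
Qed.

(** Chernoff's method with the thresholds [c < 2c < 3c]: the gap from [c] to [2c] absorbs the
    second-order error in expanding [exp(-t phi)], and the gap from [2c] to [3c] gives the
    exponential decay. *)
Lemma word_mean_deviation g c : 0 < c -> mean_le g c ->
  exists A r : R, [/\ 0 <= A, 0 < r < 1 & forall n z,
    word_mean n (fun s => (3 * c * n%:R <= orbit_sum g s z)%R%:R) <= A * r ^+ n].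
Proof.
move=> c0 [phi [B phiB] H].
have [B1 B1_ge1 phiB1] : exists2 B1, 1 <= B1 & forall z, `|phi z| <= B1.
  exists (Num.max 1 B); first by rewrite le_max lexx.
  by move=> z; rewrite le_max phiB orbT.
(* The first bound keeps exponents at most 1/2, as the quadratic estimate requires; the second makes
   the error [8 t^2 B1^2] at most [t c]. *)
pose t := Num.min (4 * B1)^-1 (c / (8 * B1 ^+ 2)).
have B0 : 0 < B1 by rewrite (lt_le_trans ltr01).
have t0 : 0 < t by rewrite lt_min invr_gt0 divr_gt0 ?mulr_gt0// exprn_gt0.
have tB : t * (2 * B1) <= 2^-1.
  have : t <= (4 * B1)^-1 by rewrite ge_min lexx.
  rewrite -(ler_pM2r (mulr_gt0 (ltr0n _ 4) B0)) mulVf ?gt_eqF ?mulr_gt0//; lra.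
have tB2 : 8 * t * B1 ^+ 2 <= c.
  have : t <= c / (8 * B1 ^+ 2) by rewrite ge_min lexx orbT.
  by rewrite ler_pdivlMr ?mulr_gt0 ?exprn_gt0//; lra.
have key y : expR (t * (g y - 2 * c)) * transfer (fun x => expR (- t * phi x)) y <=
    expR (- t * phi y).
  rewrite -ler_pdivlMl ?expR_gt0// -expRN.
  have e x : expR (- t * phi x) <= expR (- t * phi y) *
      (1 - t * (phi x - phi y) + 8 * t ^+ 2 * B1 ^+ 2).
    rewrite -ler_pdivrMl ?expR_gt0// -expRN -expRD.
    have -> : - (- t * phi y) + - t * phi x = - (t * (phi x - phi y)) by ring.
    have : `|phi x - phi y| <= 2 * B1.
      by have := ler_normB (phi x) (phi y); have := phiB1 x; have := phiB1 y; lra.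
    rewrite ler_norml => /andP[l1 l2].
    have /expR_le_quadratic/le_trans : - (t * (phi x - phi y)) <= 2^-1.
      have : t * (- (2 * B1)) <= t * (phi x - phi y) by rewrite ler_pM2l.
      lra.
    apply.
    have : (phi x - phi y) ^+ 2 <= (2 * B1) ^+ 2.
      by rewrite -subr_ge0 subr_sqr mulr_ge0; lra.
    move/(ler_wpM2l (ltW (mulr_gt0 (ltr0n _ 2) (exprn_gt0 2 t0)))).
    by rewrite sqrrN !exprMn; lra.
  apply: (@le_trans _ _ (expR (- t * phi y) *
      (1 - t * (transfer phi y - phi y) + 8 * t ^+ 2 * B1 ^+ 2))).
    have := lerD (ler_wpM2l (ltW p0_gt0) (e (f0 y))) (ler_wpM2l (ltW p1_gt0) (e (f1 y))).
    move=> /le_trans; apply; rewrite /transfer.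
    have -> : p1 = 1 - p0 by rewrite -p01 addrAC subrr add0r.
    by rewrite le_eqVlt; apply/orP; left; apply/eqP; ring.
  rewrite mulrC ler_pM2r ?expR_gt0//; apply: le_trans (expR_ge1Dx _).
  have := ler_wpM2l (ltW t0) (H y).
  have := ler_wpM2l (ltW t0) tB2.
  rewrite !expr2; lra.
(* Markov's inequality: the boundary terms [phi z] and [phi (run s z)] cost at most [exp(t B1)]
   each. *)
exists (expR (2 * t * B1)), (expR (- (t * c))); split.
- exact: expR_ge0.
- by rewrite expR_gt0 expR_lt1 oppr_lt0 mulr_gt0.
move=> n z; rewrite -expRM_natl.
apply: (@le_trans _ _ (expR (t * B1 - t * c * n%:R) * expR (- t * phi z))); last first.
  rewrite -!expRD ler_expR; have := phiB1 z; rewrite ler_norml => /andP[+ _].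
  by rewrite -(ler_pM2l t0); rewrite mulNr -mulr_natl; lra.
apply: le_trans (ler_wpM2l (expR_ge0 _) (word_mean_expR n z key)).
rewrite -word_meanZ; apply: word_mean_le => s sn.
case: (boolP (_ <= orbit_sum g s z)%R) => [h|_]; last first.
  by rewrite mulr_ge0 ?expR_ge0.
apply: (@le_trans _ _ (expR 0)); first by rewrite expR0.
rewrite -expRD ler_expR sn.
have := phiB1 (run s z); rewrite ler_norml => /andP[_].
rewrite -(ler_pM2l t0).
by have := ler_wpM2l (ltW t0) h; lra.
Qed.

(** * The probability of staying in a set *)

Fixpoint stays (B : set T) s z : bool :=
  (z \in B) && (if s is b :: s' then stays B s' (step b z) else true).

(** A word of length [n] tests [n + 1] points, both endpoints included; thus [survival B 0] is the
    indicator of [B]. *)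
Definition survival (B : set T) n z := word_mean n (fun s => (stays B s z)%:R).

Lemma survivalS B n z :
  survival B n.+1 z = (z \in B)%:R * transfer (survival B n) z.
Proof.
rewrite /survival/= /transfer; case: (z \in B) => /=; first by rewrite mul1r.
have w0 : word_mean n (fun=> 0) = 0.
  by rewrite -[LHS]/(word_mean n (fun=> false%:R)) -(mul0r (word_mean n (fun=> 1)))
    -word_meanZ; congr (word_mean n _); apply/funext => s; rewrite mul0r.
by rewrite w0 !mulr0 addr0 mul0r.
Qed.

Lemma survival_itv B n z : 0 <= survival B n z <= 1.
Proof.
elim: n z => [|n IH] z.
  by rewrite /survival/= andbT; case: (z \in B); rewrite lexx ler01.
rewrite survivalS; have /andP[a0 a1] := IH (f0 z); have /andP[b0 b1] := IH (f1 z).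
have m0 : 0 <= transfer (survival B n) z by rewrite addr_ge0// mulr_ge0// ltW.
have m1 : transfer (survival B n) z <= 1.
  by rewrite -p01 lerD// ler_piMr// ltW.
by case: (z \in B); rewrite ?mul0r ?mul1r ?m0 ?lexx ?ler01.
Qed.

Lemma survival_nincr B n z : survival B n.+1 z <= survival B n z.
Proof.
elim: n z => [|n IH] z.
  rewrite survivalS {2}/survival/= andbT ler_piMr//.
  have /andP[_ a1] := survival_itv B 0 (f0 z).
  have /andP[_ b1] := survival_itv B 0 (f1 z).
  by rewrite -p01 lerD// ler_piMr// ltW.
rewrite survivalS [leRHS]survivalS ler_wpM2l//.
by rewrite lerD// ler_pM2l.
Qed.

(** The Markov property at time [N]: the left side is the probability of being in [B] at all times
    from [N] to [N + n]. *)
Lemma word_mean_stays B N n z :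
  word_mean (N + n) (fun s => (stays B (drop N s) (run (take N s) z))%:R) =
  iter N transfer (survival B n) z.
Proof.
elim: N z => [|N IH] z.
  by rewrite add0n /survival; congr word_mean; apply/funext => s; rewrite drop0 take0.
by rewrite addSn /= /transfer -!IH; congr (_ * _ + _ * _).
Qed.

Definition weight s : R := \prod_(b <- s) (if b then p1 else p0).

Lemma weight_gt0 s : 0 < weight s.
Proof. by apply: prodr_gt0 => b _; case: b. Qed.

(** * Vanishing of subharmonic functions under a Lyapunov condition *)

Section NoSurvival.
Variables (S0 B U : set T) (ws : seq (seq bool)) (V q : T -> R) (gamma : R).
Hypotheses (S0f : forall b z, S0 z -> S0 (step b z))
  (V_ge0 : forall z, 0 <= V z)
  (V_ge1 : forall z, S0 z -> B z -> 1 <= V z)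
  (gamma_itv : 0 <= gamma < 1)
  (V_transfer : forall z, S0 z -> B z -> transfer V z <= gamma * V z)
  (hit : forall z, S0 z -> ~ B z -> exists2 s, s \in ws & U (run s z))
  (q_ge0 : forall z, 0 <= q z) (q_le1 : forall z, q z <= 1)
  (qU : forall z, U z -> q z = 0) (q_transfer : forall z, q z <= transfer q z).

(** Follow the word [s]: with probability [weight s] its end is reached, and any other choice of
    letter leads to a point of [S0], where [q] is at most [a]. *)
Lemma subtransfer_run a s z : 0 <= a -> (forall y, S0 y -> q y <= a) -> S0 z ->
  q z <= weight s * q (run s z) + (1 - weight s) * a.
Proof.
move=> a0 qa; elim: s z => [|b s IH] z Sz.
  by rewrite /weight big_nil mul1r subrr mul0r addr0.
rewrite /weight big_cons -/(weight s).
have p1E : p1 = 1 - p0 by rewrite -p01 addrAC subrr add0r.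
apply: (le_trans (q_transfer z)).
case: b; rewrite /transfer /=.
  have := ler_wpM2l (ltW p1_gt0) (IH _ (S0f true Sz)).
  have := ler_wpM2l (ltW p0_gt0) (qa _ (S0f false Sz)).
  by rewrite /step p1E; lra.
have := ler_wpM2l (ltW p0_gt0) (IH _ (S0f false Sz)).
have := ler_wpM2l (ltW p1_gt0) (qa _ (S0f true Sz)).
by rewrite /step p1E; lra.
Qed.

(** Off [B], some word of probability at least [c] ends in [U], where [q] vanishes, which gives the
    factor [1 - c]. On [B], the contraction of [V] shows that the mass remaining in [B] is
    negligible, so the same factor holds there. *)
Lemma subtransfer_contract a c : 0 <= a -> c <= 1 ->
  (forall s, s \in ws -> c <= weight s) ->
  (forall y, S0 y -> q y <= a) -> forall y, S0 y -> q y <= (1 - c) * a.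
Proof.
move=> a0 c1 cw qa.
have out y : S0 y -> ~ B y -> q y <= (1 - c) * a.
  move=> Sy /(hit Sy)[s sw Us]; apply: le_trans (subtransfer_run s a0 qa Sy) _.
  by rewrite (qU Us) mulr0 add0r ler_wpM2r// lerB// cw.
have [g0 g1] := andP gamma_itv.
(* The case [j = 0] uses [V >= 1] on [B]; each further step inside [B] gains a factor [gamma] on the
   first term only. *)
have step_j j : forall y, S0 y -> q y <= gamma ^+ j * (a * V y) + (1 - c) * a.
  elim: j => [|j IH] y Sy; (have [By|/(out y Sy) qy] := pselect (B y); last first;
    [by rewrite (le_trans qy)// lerDr !mulr_ge0// exprn_ge0|]).
    rewrite expr0 mul1r (le_trans (qa y Sy))// ler_wpDr//.
      by rewrite mulr_ge0// subr_ge0.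
    by rewrite ler_peMr// V_ge1.
  apply: (le_trans (q_transfer y)).
  have := lerD (ler_wpM2l (ltW p0_gt0) (IH _ (S0f false Sy)))
               (ler_wpM2l (ltW p1_gt0) (IH _ (S0f true Sy))).
  move=> /le_trans; apply.
  have := ler_wpM2l (mulr_ge0 (exprn_ge0 j g0) a0) (V_transfer Sy By).
  rewrite /transfer /step exprSr.
  have -> : p1 = 1 - p0 by rewrite -p01 addrAC subrr add0r.
  by rewrite /=; move: (gamma ^+ j) => x; lra.
move=> y Sy.
have /cvgrPdist_le cv : gamma ^+ j * (a * V y) @[j --> \oo] --> (0 * (a * V y)).
  by apply: cvgMl; apply: cvg_expr; rewrite ger0_norm.
apply/ler_addgt0Pl => e e0; have [j _ /(_ j)] := cv e e0.
rewrite /= leqnn mul0r sub0r normrN => /(_ isT) je.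
apply: (le_trans (step_j j y Sy)).
by rewrite lerD2r (le_trans (ler_norm _)).
Qed.

(** The finitely many words of [ws] have a common positive lower bound [c] on their weights, so the
    contraction iterates from the initial bound 1. *)
Lemma subtransfer_eq0 z : S0 z -> q z = 0.
Proof.
have [c /andP[c0 c1] cw] : exists2 c, 0 < c <= 1 & forall s, s \in ws -> c <= weight s.
  elim: ws => [|s w [c /andP[c0 c1] cw]]; first by exists 1 => //; rewrite ltr01 lexx.
  exists (Num.min c (weight s)).
    by rewrite lt_min c0 weight_gt0 ge_min c1.
  move=> s'; rewrite inE => /predU1P[->|/cw sw]; first by rewrite ge_min lexx orbT.
  by rewrite ge_min sw.
have pow k : forall y, S0 y -> q y <= (1 - c) ^+ k.
  elim: k => [|k IH] y Sy; first by rewrite expr0.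
  by rewrite exprS; apply: subtransfer_contract => //; rewrite exprn_ge0// subr_ge0.
move=> Sz; apply/eqP; rewrite eq_le q_ge0 andbT.
have /cvgrPdist_le cv : (1 - c) ^+ j @[j --> \oo] --> (0 : R).
  by apply: cvg_expr; rewrite ger0_norm ?subr_ge0// ltrBlDr ltrDl.
apply/ler_addgt0Pl => e e0; rewrite addr0; have [j _ /(_ j)] := cv e e0.
rewrite /= leqnn sub0r normrN => /(_ isT) je.
by rewrite (le_trans (pow j z Sz))// (le_trans (ler_norm _)).
Qed.

End NoSurvival.

End MarkovOperator.

(** * The Bernoulli measure *)

Section Bernoulli.
Context {R : realType}.
Variables (p0 p1 : R) (nup : probability (borel cantor_space) R).
Hypotheses (p0_gt0 : 0 < p0) (p1_gt0 : 0 < p1) (p01 : p0 + p1 = 1).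
Hypothesis nupE : bernoulli_measure p0 p1 nup.

Lemma measurable_coordinate i b :
  measurable ([set w : cantor_space | w i = b] : set (borel cantor_space)).
Proof.
apply: sub_sigma_algebra.
have -> : [set w : cantor_space | w i = b] =
    (@proj nat (fun=> bool) i : cantor_space -> bool) @^-1` [set b] by [].
apply: open_comp; last exact: discrete_open.
by move=> w _; exact: proj_continuous.
Qed.

Lemma measurable_mkseq n (P : pred (seq bool)) :
  measurable ([set w : cantor_space | P (mkseq w n)] : set (borel cantor_space)).
Proof.
elim: n P => [|n IH] P.
  have [P0|P0] := pselect (P [::]).
    have -> : [set w : cantor_space | P (mkseq w 0)] = setT by apply/seteqP; split.
    exact: measurableT.
  have -> : [set w : cantor_space | P (mkseq w 0)] = set0 by apply/seteqP; split.
  exact: measurable0.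
have -> : [set w : cantor_space | P (mkseq w n.+1)] =
  ([set w : cantor_space | w n = true] `&`
   [set w : cantor_space | P (rcons (mkseq w n) true)]) `|`
  ([set w : cantor_space | w n = false] `&`
   [set w : cantor_space | P (rcons (mkseq w n) false)]).
  apply/seteqP; split=> w /=; rewrite mkseqS.
    by case: (w n) => ?; [left|right].
  by case=> -[->].
apply: (@measurableU _ (borel cantor_space)); apply: measurableI;
  try exact: measurable_coordinate.
  exact: (IH (fun s => P (rcons s true))).
exact: (IH (fun s => P (rcons s false))).
Qed.

(** The prefix [u] is a generalization for the induction: fixing one more letter shortens the free
    part of [word_mean], until only a cylinder is left. *)
Lemma bernoulli_prefix u n (P : pred (seq bool)) :
  nup [set w : cantor_space | (mkseq w (size u) == u) && P (mkseq w (size u + n))] =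
  (weight p0 p1 u * word_mean p0 p1 n (fun s => (P (u ++ s))%:R))%:E.
Proof.
elim: n u => [|n IH] u /=.
  rewrite addn0 cats0; have [Pu|/negbTE Pu] := boolP (P u); last first.
    rewrite mulr0 (_ : [set w | _] = set0) ?measure0//.
    by apply/seteqP; split=> // w /= /andP[/eqP ->]; rewrite Pu.
  rewrite mulr1.
  have -> : weight p0 p1 u = \prod_(i < size u) (if nth false u i then p1 else p0).
    by rewrite /weight (big_nth false) big_mkord.
  rewrite -nupE; congr (nup _); apply/seteqP; split=> w /=.
    move=> /andP[/eqP uE _] i iu; rewrite -{1}uE nth_mkseq//.
  move=> uE; suff -> : mkseq w (size u) = u by rewrite eqxx.
  apply: (@eq_from_nth _ false); first by rewrite size_mkseq.
  by move=> i; rewrite size_mkseq => iu; rewrite nth_mkseq// uE.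
pose E b : set (borel cantor_space) := [set w : cantor_space | (mkseq w (size (rcons u b)) == rcons u b) &&
  P (mkseq w (size (rcons u b) + n))].
have mE b : measurable (E b).
  have := measurable_mkseq (size (rcons u b) + n)
    (fun s => (take (size (rcons u b)) s == rcons u b) && P s).
  congr (measurable _); apply/seteqP; split=> w;
  by rewrite /E /= -map_take take_iota (minn_idPl _) ?leq_addr.
have -> : [set w : cantor_space | (mkseq w (size u) == u) &&
    P (mkseq w (size u + n.+1))] = E false `|` E true.
  apply/seteqP; split=> w; rewrite /E /= !size_rcons addSnnS mkseqS !eqseq_rcons.
    by case: (w (size u)) => /andP[-> ->]; [right|left].
  by case=> /andP[/andP[-> _] ->].
have -> : nup (E false `|` E true) = (nup (E false) + nup (E true))%E.
  apply: measureU => //; apply/seteqP; split=> // w; rewrite /E /= !size_rcons !mkseqS !eqseq_rcons.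
  by case: (w (size u)); rewrite /= ?andbF//= => -[].
have nE b : nup (E b) = (weight p0 p1 (rcons u b) *
  word_mean p0 p1 n (fun s => (P (rcons u b ++ s))%:R))%:E by exact: IH.
rewrite !nE.
rewrite -EFinD /weight -!cats1 !big_cat !big_seq1 /=; congr (_%:E).
rewrite mulrDr !mulrA; congr (_ * word_mean _ _ _ _ + _ * word_mean _ _ _ _);
by apply/funext => s; rewrite -catA.
Qed.

Lemma bernoulli_mkseq n (P : pred (seq bool)) :
  nup [set w : cantor_space | P (mkseq w n)] =
  (word_mean p0 p1 n (fun s => (P s)%:R))%:E.
Proof.
have := bernoulli_prefix [::] n P; rewrite /weight big_nil mul1r /= => <-.
by congr (nup _); apply/seteqP; split=> w /=; rewrite add0n ?eqxx.
Qed.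

Variables (f0 f1 : sphere R -> sphere R).

Lemma random_orbitE w n z : random_orbit f0 f1 w n z = run f0 f1 (mkseq w n) z.
Proof.
by elim: n => [//|n IH]; rewrite mkseqS /run -cats1 foldl_cat /= IH.
Qed.

Lemma orbit_sum_visits (B : set (sphere R)) (w : cantor_space) z N :
  orbit_sum f0 f1 \1_(~` B) (mkseq w N) z =
  N%:R - (visits f0 f1 w z B N)%:R :> R.
Proof.
(* [orbit_sum] recurses on the front of the word, whereas [visits] grows at the back. *)
have rc s b : orbit_sum f0 f1 \1_(~` B) (rcons s b) z =
    orbit_sum f0 f1 \1_(~` B) s z + \1_(~` B) (run f0 f1 s z) :> R.
  elim: s z => [|c s IH] y /=; first by rewrite addr0 add0r.
  by rewrite IH addrA.
elim: N => [|N IH]; first by rewrite /visits /= subrr.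
rewrite mkseqS rc IH /visits -addn1 iotaD count_cat /= addn0 add0n.
rewrite random_orbitE indicE in_setC !natrD.
set a := run _ _ _ _; set x := (count _ _)%:R.
have -> : (a \in B) = `[< B a >] by [].
by case: `[< B a >] => /=; ring.
Qed.

(** For each [k], the deviation bound with [c = 1/(k+1)] is summable in [n], so by Borel-Cantelli
    the frequency outside [B] is eventually below [3/(k+1)]; then all [k] are taken together. *)
Lemma visits_cvg (B : set (sphere R)) z :
  mean_le0 f0 f1 p0 p1 \1_(~` B) ->
  {ae nup, forall w : cantor_space,
    ((visits f0 f1 w z B N)%:R / N%:R : R) @[N --> \oo] --> (1 : R)}.
Proof.
move=> HB; pose c k : R := k.+1%:R^-1.
have c0 k : 0 < c k by rewrite invr_gt0.
pose F k n : set (borel cantor_space) := [set w : cantor_space |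
  (3 * c k * n%:R <= orbit_sum f0 f1 \1_(~` B) (mkseq w n) z :> R)%R].
have mF k n : measurable (F k n).
  exact: (measurable_mkseq n
    (fun s => (3 * c k * n%:R <= orbit_sum f0 f1 \1_(~` B) s z :> R)%R)).
have nF k n : nup (F k n) = (word_mean p0 p1 n
    (fun s => (3 * c k * n%:R <= orbit_sum f0 f1 \1_(~` B) s z :> R)%R%:R))%:E.
  exact: (bernoulli_mkseq n
    (fun s => (3 * c k * n%:R <= orbit_sum f0 f1 \1_(~` B) s z :> R)%R)).
have F0 k : nup (lim_sup_set (F k)) = 0.
  apply: lim_sup_set_cvg0 => //.
  have [a [r [a0 /andP[r0 r1] H]]] :=
    word_mean_deviation p0_gt0 p1_gt0 p01 (c0 k) (HB _ (c0 k)).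
  have partial n : (\sum_(0 <= i < n) nup (F k i) <= (a / (1 - r))%:E)%E.
    apply: (@le_trans _ _ (\sum_(0 <= i < n) (a * r ^+ i)%:E)%E).
      by apply: lee_sum => i _; rewrite nF lee_fin; exact: H.
    rewrite sumEFin lee_fin -mulr_sumr ler_wpM2l//.
    rewrite -[leRHS]mul1r ler_pdivlMr ?subr_gt0// mulrC.
    have -> : (1 - r) * \sum_(0 <= i < n) r ^+ i = 1 - r ^+ n.
      by rewrite big_mkord -opprB mulNr -subrX1 opprB.
    by rewrite lerBlDr lerDl exprn_ge0 ?ltW.
  apply: (@le_lt_trans _ _ (a / (1 - r))%:E); last exact: ltry.
  apply: lime_le; first by apply: is_cvg_nneseries => n _ _; exact: measure_ge0.
  by apply: nearW => n; exact: partial.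
have : {ae nup, forall w : cantor_space, forall k, exists n0, forall n,
    (n0 <= n)%N -> ~ F k n w}.
  apply: ae_foralln => k.
  exists (lim_sup_set (F k)); split; last 2 first.
  - exact: F0.
  - move=> w /= nF' n _; apply: contrapT => nn; apply: nF'; exists n => m nm Fw.
    by apply: nn; exists m.
  by apply: bigcapT_measurable => n; apply: bigcup_measurable => // m _; exact: mF.
case=> E [mE E0 nE]; exists E; split=> //; apply: subset_trans nE.
apply: subsetC => w /= H.
apply/cvgrPdist_le => e e0.
have [k ke] : exists k, 3 * c k <= e.
  exists (Num.truncn (3 / e)); rewrite /c ler_pdivrMr ?ltr0n//.
  rewrite -ler_pdivrMl// mulrC; apply: ltW; exact: truncnS_gt.
have [n0 nFw] := H k; near=> n.
have n0n : (n0 <= n)%N by near: n; exact: nbhs_infty_ge.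
have n_gt0 : 0 < n%:R :> R by rewrite ltr0n; near: n; exact: nbhs_infty_gt.
have /negP := nFw n n0n; rewrite -ltNge orbit_sum_visits => nk.
have vn : (visits f0 f1 w z B n)%:R <= n%:R :> R.
  by rewrite ler_nat (leq_trans (count_size _ _))// size_iota.
have -> : 1 - (visits f0 f1 w z B n)%:R / n%:R =
    (n%:R - (visits f0 f1 w z B n)%:R) / n%:R :> R.
  by rewrite mulrBl divff ?gt_eqF.
rewrite ger0_norm; last by rewrite divr_ge0// subr_ge0.
rewrite ler_pdivrMr//.
by rewrite (le_trans (ltW nk))// ler_pM2r.
Unshelve. all: by end_near. Qed.

(** * Orbits leave a given set infinitely often *)

Section Recurrence.
Variables (S0 B0 B : set (sphere R)) (ws : seq (seq bool))
  (V : sphere R -> R) (gamma : R).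
Hypotheses (S0f : forall b z, S0 z -> S0 (step f0 f1 b z))
  (V_ge0 : forall z, 0 <= V z)
  (V_ge1 : forall z, S0 z -> B0 z -> 1 <= V z)
  (gamma_itv : 0 <= gamma < 1)
  (V_transfer : forall z, S0 z -> B0 z -> transfer f0 f1 p0 p1 V z <= gamma * V z)
  (hit : forall z, S0 z -> ~ B0 z -> exists2 s, s \in ws & ~ B (run f0 f1 s z)).

(** The survival probabilities decrease to a limit [q] that vanishes off [B]; letting [n] grow in
    [survivalS] gives [q <= transfer q], so [subtransfer_eq0] applies with [U] the complement of
    [B]. *)
Lemma survival_cvg0 z : S0 z -> survival f0 f1 p0 p1 B n z @[n --> \oo] --> (0 : R).
Proof.
pose sv n y := survival f0 f1 p0 p1 B n y.
pose q y := limn (fun n => sv n y).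
have sv01 n y : 0 <= sv n y <= 1 by exact: survival_itv.
have sv_cvg y : cvgn (fun n => sv n y).
  apply: nonincreasing_is_cvgn; last first.
    by exists 0 => _ [n _ <-]; case/andP: (sv01 n y).
  by apply/nonincreasing_seqP => n; exact: survival_nincr.
suff q0 : S0 z -> q z = 0 by move=> /q0 <-; exact: sv_cvg.
apply: (@subtransfer_eq0 _ _ f0 f1 p0 p1 p0_gt0 p1_gt0 p01 S0 B0 (~` B) ws V q gamma) => //.
- by move=> y; apply: limr_ge => //; apply: nearW => n; case/andP: (sv01 n y).
- by move=> y; apply: limr_le => //; apply: nearW => n; case/andP: (sv01 n y).
- move=> y nBy; apply: cvg_lim => //.
  apply: cvg_near_cst; apply: nearW => n; rewrite /sv.
  have yB : (y \in B) = false by apply/negP; rewrite inE.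
  by case: n => [|n]; rewrite ?survivalS ?/survival/= ?yB// mul0r.
- move=> y.
  have cv : transfer f0 f1 p0 p1 (sv n) y @[n --> \oo] --> transfer f0 f1 p0 p1 q y.
    by apply: cvgD; apply: cvgMr; exact: sv_cvg.
  rewrite -(cvg_lim _ cv)//; apply: limr_ge.
    by apply/cvg_ex; exists (transfer f0 f1 p0 p1 q y).
  apply: nearW => n.
  have : sv n.+1 y <= transfer f0 f1 p0 p1 (sv n) y.
    rewrite /sv survivalS ler_piMl//; last by case: (_ \in _).
    by apply: transfer_ge0 => // x; case/andP: (sv01 n x).
  apply: le_trans; apply: (nonincreasing_cvgn_ge (u_ := fun n => sv n y)) => //.
  by apply/nonincreasing_seqP => m; exact: survival_nincr.
Qed.

(** Staying in [B] from time [N] on is contained in each event [E n], whose probability is the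
    [N]-th transfer of a survival probability and tends to 0. *)
Lemma random_orbit_leaves z : S0 z ->
  {ae nup, forall w : cantor_space, forall N : nat,
    exists2 n, (N <= n)%N & ~ B (random_orbit f0 f1 w n z)}.
Proof.
move=> Sz; apply: ae_foralln => N.
pose E n : set (borel cantor_space) := [set w : cantor_space |
  stays f0 f1 B (drop N (mkseq w (N + n))) (run f0 f1 (take N (mkseq w (N + n))) z)].
have mE n : measurable (E n).
  exact: (measurable_mkseq (N + n)
    (fun s => stays f0 f1 B (drop N s) (run f0 f1 (take N s) z))).
have nE n : nup (E n) = (iter N (transfer f0 f1 p0 p1) (survival f0 f1 p0 p1 B n) z)%:E.
  rewrite -word_mean_stays; exact: (bernoulli_mkseq (N + n)
    (fun s => stays f0 f1 B (drop N s) (run f0 f1 (take N s) z))).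
have mcap : measurable (\bigcap_n E n).
  exact: bigcapT_measurable.
exists (\bigcap_n E n); split => //.
  have cv : iter N (transfer f0 f1 p0 p1) (survival f0 f1 p0 p1 B n) z
      @[n --> \oo] --> (0 : R).
    elim: N z Sz {E mE nE mcap} => [|N IH] y Sy; first exact: survival_cvg0.
    pose g x n := iter N (transfer f0 f1 p0 p1) (survival f0 f1 p0 p1 B n) x.
    have c0 : p0 * g (f0 y) n @[n --> \oo] --> p0 * 0.
      by apply: cvgMr; exact: (IH _ (S0f false Sy)).
    have c1 : p1 * g (f1 y) n @[n --> \oo] --> p1 * 0.
      by apply: cvgMr; exact: (IH _ (S0f true Sy)).
    have -> : 0 = p0 * 0 + p1 * 0 by rewrite !mulr0 addr0.
    exact: (cvgD c0 c1).
  apply/eqP; rewrite eq_le measure_ge0 andbT.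
  apply/lee_addgt0Pr => e e0; rewrite add0e.
  have /cvgrPdist_le/(_ e e0)[n _ /(_ n)] := cv.
  rewrite /= leqnn sub0r normrN => /(_ isT) ne.
  apply: (@le_trans _ _ (nup (E n))).
    by apply: le_measure; rewrite ?inE//; exact: bigcap_inf.
  by rewrite nE lee_fin (le_trans (ler_norm _)).
move=> w /= nw n _; rewrite /E /=.
have Bw m : (N <= m)%N -> B (random_orbit f0 f1 w m z).
  by move=> Nm; apply: contrapT => nB; apply: nw; exists m.
have -> : take N (mkseq w (N + n)) = mkseq w N.
  by rewrite -map_take take_iota (minn_idPl _) ?leq_addr.
have -> : drop N (mkseq w (N + n)) = map w (iota N n).
  by rewrite -map_drop drop_iota add0n addKn.
rewrite -random_orbitE.
elim: n N Bw {E mE nE mcap nw} => [|n IH] N Bw /=; first by rewrite andbT inE; exact: Bw.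
by apply/andP; split; [rewrite inE; exact: Bw|apply: (IH N.+1) => m /ltnW; exact: Bw].
Qed.

End Recurrence.
End Bernoulli.

(** * Topology of the sphere *)

Section SphereTopology.
Local Open Scope complex_scope.
Context {R : realType}.
Local Notation C := R[i].
Local Notation S := (sphere R).
Local Notation normC := (@cmod R).
Implicit Types (x y : C) (z : S) (f : S -> S).

Lemma normc_cmod x : `|x| = (normC x)%:C.
Proof. by case: x => a b; rewrite normc_def. Qed.

Lemma cmod_ge0 x : 0 <= normC x.
Proof. by case: x => a b; exact: sqrtr_ge0. Qed.

Lemma cmod_eq0 x : (normC x == 0) = (x == 0).
Proof.
apply/eqP/eqP => [/ComplexField.Normc.eq0_normc //|->].
exact: ComplexField.Normc.normc0.
Qed.

Lemma cmod_gt0 x : (0 < normC x) = (x != 0).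
Proof. by rewrite lt_def cmod_eq0 cmod_ge0 andbT. Qed.

Lemma cmodN x : normC (- x) = normC x.
Proof. exact: normcN. Qed.

Lemma cmodD x y : normC (x + y) <= normC x + normC y.
Proof. exact: le_normcD. Qed.

Lemma cmodM x y : normC (x * y) = normC x * normC y.
Proof. exact: ComplexField.Normc.normcM. Qed.

Lemma cmodV x : normC x^-1 = (normC x)^-1.
Proof. exact: ComplexField.Normc.normcV. Qed.

Lemma cmodX x n : normC (x ^+ n) = normC x ^+ n.
Proof.
elim: n => [|n IH]; first by rewrite !expr0; exact: ComplexField.Normc.normc1.
by rewrite !exprS cmodM IH.
Qed.

(** Radii of balls live in [R[i]], but a positive element of [R[i]] is real; this allows real radii
    from here on. *)
Lemma nbhs_cmod x (A : set C) :
  nbhs x A <-> exists2 r : R, 0 < r & forall y, normC (y - x) < r -> A y.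
Proof.
split=> [/nbhs_ballP[e /= e0 eA]|[r r0 rA]].
  have eE : e = (complex.Re e)%:C by case: e e0 {eA} => a b /=; rewrite ltcE /= => /andP[/eqP ->].
  exists (complex.Re e); first by rewrite -ltcR -eE.
  move=> y yx; apply: eA; rewrite -ball_normE /ball_ /= distrC normc_cmod eE.
  by rewrite ltcR.
apply/nbhs_ballP; exists r%:C => /=; first by rewrite ltcR.
move=> y; rewrite -ball_normE /ball_ /= distrC normc_cmod ltcR; exact: rA.
Qed.

Lemma dnbhs_cmod x (A : set C) : dnbhs x A <->
  exists2 r : R, 0 < r & forall y, 0 < normC (y - x) < r -> A y.
Proof.
rewrite /dnbhs /within /=; split=> [/nbhs_cmod[r r0 rA]|[r r0 rA]].
  by exists r => // y /andP[y0 yr]; apply: rA; rewrite // -subr_eq0 -cmod_gt0.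
apply/nbhs_cmod; exists r => // y yr yx; apply: rA.
by rewrite yr andbT cmod_gt0 subr_eq0.
Qed.

Lemma closed_cmod_le (r : R) : closed [set x : C | normC x <= r].
Proof.
rewrite -openC openE => x /= /negP; rewrite -ltNge => rx.
apply/nbhs_cmod; exists (normC x - r); first by rewrite subr_gt0.
move=> y; rewrite -normcN opprB => xy; apply/negP; rewrite -ltNge.
by have := cmodD (x - y) y; rewrite subrK; lra.
Qed.

Lemma cmod_le_norm (a b : R) : normC (a +i* b) <= `|a| + `|b|.
Proof.
rewrite -[leRHS]ger0_norm ?addr_ge0// -sqrtr_sqr ler_wsqrtr//.
rewrite sqrrD !real_normK ?num_real// lerD2r lerDl mulrn_wge0// mulr_ge0.
Qed.

Lemma compact_cmod_le (r : R) : compact [set x : C | normC x <= r].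
Proof.
pose g (ab : R * R) : C := ab.1 +i* ab.2.
have gc : continuous g.
  move=> [a b] A /nbhs_cmod[e e0 eA].
  have e20 : 0 < e / 2 by rewrite divr_gt0.
  exists (ball a (e / 2), ball b (e / 2)) => /=; first by split; exact: nbhsx_ballx.
  move=> [a' b'] /= [aa bb]; apply: eA; rewrite /g /=.
  apply: le_lt_trans (cmod_le_norm _ _) _; move: aa bb.
  by rewrite -!ball_normE /ball_ /= !(distrC _ a') !(distrC _ b'); lra.
apply: (@subclosed_compact _ _ (g @` (`[- r, r] `*` `[- r, r]))).
- exact: closed_cmod_le.
- apply: continuous_compact; first exact: continuous_subspaceT.
  by apply: compact_setX; exact: segment_compact.
move=> [a b] /= abr; exists (a, b) => //=.
rewrite !in_itv /= -!ler_norml; split; apply: le_trans abr.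
  by rewrite -sqrtr_sqr ler_wsqrtr// lerDl sqr_ge0.
by rewrite -sqrtr_sqr ler_wsqrtr// lerDr sqr_ge0.
Qed.

Lemma compact_bounded_cmod (K : set C) : compact K ->
  exists r : R, forall x, K x -> normC x <= r.
Proof.
move=> /compact_near_coveringP cK.
have := cK nat \oo (fun n x => normC x <= n%:R) _ _; case.
  move=> x Kx; exists ([set y | normC (y - x) < 1], [set n | normC x + 1 <= n%:R]) => /=.
    split; first by apply/nbhs_cmod; exists 1.
    by near=> n; near: n; exact: nbhs_infty_ger.
  move=> [y n] /= [yx xn]; have := cmodD (y - x) x; rewrite subrK.
  lra.
move=> n _ /(_ n) /=; rewrite leqnn => /(_ isT) H.
by exists n%:R => x /H.
Unshelve. all: by end_near. Qed.

Definition far (r : R) : set S := [set z | if z is Some x then r < normC x else True].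

(** Neighbourhoods of infinity are complements of closed compact sets, and every compact set lies in
    a closed disc. *)
Lemma nbhs_infty (A : set S) :
  nbhs (infty R) A <-> exists r, far r `<=` A.
Proof.
split=> [[K [cK _] KA]|[r rA]].
  have [r Kr] := compact_bounded_cmod cK.
  exists r => -[x|] /= rx; last by apply: KA; right.
  by apply: KA; left; exists x => //= /Kr; rewrite leNgt rx.
exists [set x | normC x <= r].
  by split; [exact: compact_cmod_le|exact: closed_cmod_le].
move=> z [[x /= /negP xr <-]|->]; apply: rA => //=.
by rewrite ltNge.
Qed.

Lemma open_far r : open (far r).
Proof.
rewrite openE => -[x|] rx; last by apply/nbhs_infty; exists r.
apply/nbhs_cmod; exists (normC x - r); first by rewrite subr_gt0.
move=> y; rewrite -cmodN opprB /= => xy.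
by have := cmodD (x - y) y; rewrite subrK; lra.
Qed.

Lemma open_sphere_ball (e : R) : open (sphere_ball e : set S).
Proof.
rewrite openE => _ [x -> xe].
apply/nbhs_cmod; exists (e - normC x); first by rewrite subr_gt0.
move=> y yx /=; exists y => //.
by have := cmodD (y - x) x; rewrite subrK; lra.
Qed.

Lemma sphere_invK : involutive (@sphere_inv R).
Proof.
move=> [x|] /=; last by rewrite eqxx.
by have [->//|x0] := eqVneq x 0; rewrite /= invr_eq0 (negbTE x0) invrK.
Qed.

Lemma chartK b : involutive (@chart R b).
Proof. by case: b => //; exact: sphere_invK. Qed.

Lemma sphere_inv_continuous : continuous (@sphere_inv R).
Proof.
move=> [x|] A; last first.
  move=> /= /nbhs_cmod[r r0 rA]; apply/nbhs_infty; exists r^-1 => -[y|] /=.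
    move=> ry; have y0 : y != 0.
      by rewrite -cmod_gt0 (lt_trans _ ry)// invr_gt0.
    rewrite (negbTE y0); apply: rA; rewrite subr0 cmodV.
    by rewrite invf_plt ?posrE ?cmod_gt0.
  by move=> _; apply: rA; rewrite subrr ComplexField.Normc.normc0.
have [->|x0] := eqVneq x 0.
  rewrite /= eqxx => /nbhs_infty[r rA]; apply/nbhs_cmod.
  (* The radius [r] of a set [far r] may be negative or zero, hence the maximum with 1. *)
  exists (Num.max 1 r)^-1; first by rewrite invr_gt0 lt_max ltr01.
  move=> y; rewrite subr0 => yr /=.
  case: ifPn => [_|y0]; apply: rA => //=; rewrite cmodV.
  have : Num.max 1 r < (normC y)^-1.
    by rewrite invf_pgt ?posrE ?cmod_gt0// lt_max ltr01.
  by apply: le_lt_trans; rewrite le_max lexx orbT.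
rewrite /= (negbTE x0) => nA.
have : nbhs x (fun y : C => A (Some y^-1)) by exact: (inv_continuous x0 nA).
move=> /nbhs_cmod[r r0 rA].
apply/nbhs_cmod; exists (Num.min r (normC x)); first by rewrite lt_min r0 cmod_gt0.
move=> y; rewrite lt_min => /andP[yr yx] /=.
have [y0|y0] := eqVneq y 0; last exact: rA.
by move: yx; rewrite y0 sub0r cmodN ltxx.
Qed.

Lemma chart_continuous b : continuous (@chart R b).
Proof. by case: b; [exact: sphere_inv_continuous|move=> z A]. Qed.

End SphereTopology.

(** * Local estimates at 0 and infinity *)

Section AnalyticFamily.
Local Open Scope complex_scope.
Context {R : realType}.
Local Notation C := R[i].
Local Notation S := (sphere R).
Local Notation normC := (@cmod R).
Variables (F : C -> S -> S) (l : C).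
Hypotheses (F_analytic : analytic_family F) (l_disc : `|l| < 1).
Implicit Types (x y a : C) (z : S) (s t : bool).

Lemma near_slice (a : C) (P : C * C -> Prop) :
  (\forall w \near ((l, a) : C * C), P w) -> \forall y \near a, P (l, y).
Proof.
move=> [[A B] [/= nA nB] AB]; apply: filterS nB => y By; apply: AB; split => //=.
exact: nbhs_singleton.
Qed.

Definition in_charts s t y := sphere_coord (chart t (F l (chart s (Some y)))).

(** The parameter is frozen by composing with [y |-> (l, y)]. As the chart value stays finite near
    [a] and charts are involutions, the map is recovered there from its coordinate. *)
Lemma in_charts_differentiable s t a :
  chart t (F l (chart s (Some a))) <> infty R ->
  (\forall y \near a, F l (chart s (Some y)) = chart t (Some (in_charts s t y))) /\
  derivable (in_charts s t) a 1.
Proof.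
move=> Fz; have [nz dz] := F_analytic l_disc Fz; split.
  have := near_slice nz; apply: filterS => y /=.
  rewrite /in_charts; case E : (chart t (F l _)) => [x|//] _ /=.
  by rewrite -E chartK.
apply/derivable1_diffP.
have dp : differentiable (fun y : C => ((l, y) : C * C)) a.
  apply: differentiable_pair.
    exact: differentiable_cst.
  exact: ex_diff.
exact: (differentiable_comp dp dz).
Qed.

Lemma analytic_family_continuous : continuous (F l).
Proof.
have cont s a : {for Some a, continuous (F l \o @chart R s)}.
  (* The target chart is the one in which the image point is finite. *)
  pose t := ~~ isSome (F l (chart s (Some a))).
  have Ft : chart t (F l (chart s (Some a))) <> infty R.
    by rewrite /t; case: (F l _) => [x|].
  have [nF dF] := in_charts_differentiable Ft.
  move=> A /= nA.
  have E0 := nbhs_singleton nF.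
  have dc : {for a, continuous (in_charts s t)}.
    by apply: differentiable_continuous; apply/derivable1_diffP.
  rewrite E0 in nA.
  have nA' : nbhs (Some (in_charts s t a) : S) (@chart R t @^-1` A).
    exact: chart_continuous nA.
  have nA'' := dc _ nA'.
  by apply: filterS (filterI nF nA'') => y /= [-> ].
move=> [x|]; first exact: (cont false x).
move=> A nA.
have : nbhs (Some 0 : S) ((F l \o @chart R true) @^-1` A).
  by apply: cont; rewrite /= eqxx.
have -> : Some 0 = chart true (infty R) :> S by [].
move=> /(@chart_continuous R true (infty R)) H.
have : nbhs (infty R) (@chart R true @^-1` ((F l \o @chart R true) @^-1` A)) by [].
by apply: filterS => z /=; rewrite sphere_invK.
Qed.

Lemma derivable_ratio (G : C -> C) : G 0 = 0 -> derivable G 0 1 ->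
  G y / y @[y --> 0^'] --> derive1 G 0.
Proof.
move=> G0 /cvg_ex[c dG].
have cE : (fun h : C => h^-1 *: (G (h *: 1 + 0) - G 0)) = (fun y => G y / y).
  by apply/funext => y; rewrite G0 subr0 addr0 /GRing.scale /= mulr1 mulrC.
have : h^-1 *: (G (h + 0) - G 0) @[h --> 0^'] --> c.
  have -> : (fun h : C => h^-1 *: (G (h + 0) - G 0)) = (fun y => G y / y).
    by apply/funext => y; rewrite G0 subr0 addr0 /GRing.scale /= mulrC.
  by rewrite -cE.
rewrite /derive1 => /cvg_lim -> //.
by rewrite -cE.
Qed.

Lemma cvg_cmod (G : C -> C) (c x : C) : G y @[y --> x^'] --> c ->
  forall e : R, 0 < e -> exists2 r : R, 0 < r &
    forall y, 0 < normC (y - x) < r -> `|normC (G y) - normC c| < e.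
Proof.
move=> /cvgrPdist_lt Gc e e0.
have e0' : 0 < e%:C by rewrite ltcR.
have /dnbhs_cmod[r r0 rG] := Gc _ e0'.
exists r => // y /rG; rewrite normc_cmod ltcR; apply: le_lt_trans.
rewrite ler_norml; apply/andP; split.
  by have := cmodD (c - G y) (G y); rewrite subrK; lra.
by have := cmodD (G y - c) c; rewrite subrK -(cmodN (G y - c)) opprB; lra.
Qed.

(** Near 0 the ratio of moduli is within [normC m - kappa] of [normC m], hence between [kappa] and
    [2 * normC m]. Adding 1 to the upper constant makes [ln A] nonnegative. *)
Lemma origin_estimate (kappa : R) :
  F l (origin R) = origin R -> 0 <= kappa < normC (sphere_deriv (F l) (origin R)) ->
  exists A r : R, [/\ 1 <= A, 0 < r & forall x, normC x < r ->
    exists2 y, F l (Some x) = Some y & kappa * normC x <= normC y <= A * normC x].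
Proof.
move=> F0 /andP[k0 km].
have Ft : chart false (F l (chart false (Some 0))) <> infty R.
  by rewrite /= -/(origin R) F0.
have [nF dF] := in_charts_differentiable Ft.
have G0 : in_charts false false 0 = 0.
  by rewrite /in_charts /= -/(origin R) F0.
have dE : sphere_deriv (F l) (origin R) = derive1 (in_charts false false) 0.
  rewrite /sphere_deriv /=; congr (derive1 _ _); apply/funext => y.
  by rewrite /local_expr /in_charts F0.
set m := sphere_deriv _ _ in km dE.
have e0 : 0 < normC m - kappa by rewrite subr_gt0.
have := derivable_ratio G0 dF; rewrite -dE => /cvg_cmod/(_ _ e0)[r1 r10 H1].
have /nbhs_cmod[r2 r20 H2] := nF.
exists (1 + 2 * normC m), (Num.min r1 r2); split.
- by rewrite lerDl mulr_ge0// cmod_ge0.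
- by rewrite lt_min r10.
move=> x; rewrite lt_min => /andP[x1 x2].
have := H2 x; rewrite subr0 => /(_ x2) /= Fx.
exists (in_charts false false x) => //.
have [->|x0] := eqVneq x 0.
  by rewrite G0 ComplexField.Normc.normc0 !mulr0 lexx.
have := H1 x; rewrite subr0 cmod_gt0 x0 => /(_ x1).
rewrite cmodM cmodV ltr_norml => /andP[h1 h2].
have nx : 0 < normC x by rewrite cmod_gt0.
rewrite -ler_pdivlMr// -[X in _ && X]ler_pdivrMr//.
by apply/andP; split; [lra|have := cmod_ge0 m; lra].
Qed.

(** In the coordinate [w = 1/x] the map vanishes at 0 and is differentiable there, so its value is
    [O(|w|)]. *)
Lemma pole_estimate : F l (infty R) = origin R ->
  exists A r : R, [/\ 1 <= A, 0 < r & forall x, r < normC x ->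
    exists2 y, F l (Some x) = Some y & normC x * normC y <= A].
Proof.
move=> Foo.
have Ft : chart false (F l (chart true (Some 0))) <> infty R.
  by rewrite /= eqxx -/(infty R) Foo.
have [nF dF] := in_charts_differentiable Ft.
have G0 : in_charts true false 0 = 0.
  by rewrite /in_charts /= eqxx -/(infty R) Foo.
have := derivable_ratio G0 dF; set m := derive1 _ _ => /cvg_cmod/(_ 1 ltr01)[r1 r10 H1].
have /nbhs_cmod[r2 r20 H2] := nF.
exists (1 + normC m), (Num.min r1 r2)^-1; split.
- by rewrite lerDl cmod_ge0.
- by rewrite invr_gt0 lt_min r10.
move=> x rx.
have nx : 0 < normC x by rewrite (lt_trans _ rx)// invr_gt0 lt_min r10.
have : (normC x)^-1 < Num.min r1 r2.
  by rewrite invf_plt ?posrE// lt_min r10.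
have x0 : x != 0 by rewrite -cmod_gt0.
rewrite lt_min => /andP[x1 x2].
have := H2 x^-1; rewrite subr0 cmodV => /(_ x2) /=; rewrite invr_eq0 (negbTE x0) invrK => Fx.
exists (in_charts true false x^-1) => //.
have := H1 x^-1; rewrite subr0 cmodV invr_gt0 nx => /(_ x1).
rewrite cmodM invrK ltr_norml => /andP[_]; rewrite mulrC; lra.
Qed.

End AnalyticFamily.

Section InfinityDegree.
Local Open Scope complex_scope.
Context {R : realType}.
Local Notation normC := (@cmod R).

(** In the charts at infinity [|F w|] is below [2 |c| |w|^d] for small nonzero [w]; taking inverses
    gives growth of order [d] with [a = 1 / (2 |c|)]. *)
Lemma infty_estimate (f : sphere R -> sphere R) d :
  f (infty R) = infty R -> has_local_degree f (infty R) d ->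
  exists a r : R, [/\ 0 < a, 0 < r & forall x, r < normC x ->
    f (Some x) = None \/ exists2 y, f (Some x) = Some y & a * normC x ^+ d <= normC y].
Proof.
move=> foo [c c0 /=].
have loc0 : local_expr f (infty R) 0 = 0.
  by rewrite /local_expr foo /= eqxx -/(infty R) foo.
rewrite loc0 => H.
have nc : 0 < normC c by rewrite cmod_gt0.
have [r1 r10 H1] := cvg_cmod H nc.
exists (2 * normC c)^-1, r1^-1; split; rewrite ?invr_gt0 ?mulr_gt0//.
move=> x rx.
have nx : 0 < normC x by rewrite (lt_trans _ rx)// invr_gt0.
have x0 : x != 0 by rewrite -cmod_gt0.
have := H1 x^-1; rewrite !subr0 cmodV invr_gt0 nx /= invf_plt ?posrE// => /(_ rx).
rewrite cmodM cmodV cmodX cmodV exprVn invrK /local_expr foo /=.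
rewrite invr_eq0 (negbTE x0) invrK ltr_norml => /andP[h1 h2].
case: (f (Some x)) h1 h2 => [y|] /= h1 h2; last by left.
(* For [y = 0] the chart value is infinity, with default coordinate 0; being within [normC c] of
   [normC c] excludes this. *)
right; exists y => //; move: h1 h2; case: (eqVneq y 0) => [->|y0].
  by rewrite /= !expr0n addr0 sqrtr0 mul0r sub0r ltxx.
rewrite cmodV => _ h2; have ny : 0 < normC y by rewrite cmod_gt0.
rewrite mulrC ler_pdivrMr ?mulr_gt0// -ler_pdivrMl// ltW//; lra.
Qed.

End InfinityDegree.

(** * Drift near infinity *)

Section Drift.
Local Open Scope complex_scope.
Context {R : realType}.
Local Notation C := R[i].
Local Notation S := (sphere R).
Local Notation normC := (@cmod R).
Implicit Types (x y : C) (z : S) (M t c : R).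

Definition clamp M t : R := Num.max 0 (Num.min t M).

Lemma clamp_itv M t : 0 <= M -> 0 <= clamp M t <= M.
Proof. by move=> M0; rewrite /clamp le_max lexx ge_max M0 ge_min lexx orbT. Qed.

Lemma clamp_leB M t t' c : 0 <= c -> t - c <= t' -> clamp M t - c <= clamp M t'.
Proof.
move=> c0 tt; rewrite lerBlDr {1}/clamp ge_max addr_ge0 //=; last by rewrite /clamp le_max lexx.
apply: (@le_trans _ _ (Num.min t' M + c)); last by rewrite lerD2r /clamp le_max lexx orbT.
rewrite addr_minl le_min !ge_min; apply/andP; split; apply/orP; [left|right]; lra.
Qed.

Lemma clampZ M t t' delta : 0 <= delta -> delta * t <= t' ->
  delta * clamp M t <= clamp (delta * M) t'.
Proof.
move=> d0 tt; rewrite {1}/clamp maxr_pMr// minr_pMr// mulr0.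
by have := @clamp_leB (delta * M) (delta * t) t' 0 (lexx _); rewrite !subr0; exact.
Qed.

(** Truncation makes [depth] and [height] bounded, as a corrector in [mean_le] must be; the values
    at 0 and infinity are the limits. *)
Definition depth M z : R :=
  if z is Some x then if x == 0 then M else clamp M (- ln (normC x)) else 0.

Definition height r M z : R :=
  if z is Some x then if r < normC x then clamp M (ln (normC x)) else 0 else M.

Lemma depth_itv M z : 0 <= M -> 0 <= depth M z <= M.
Proof.
case: z => [x|] M0 /=; last by rewrite lexx.
by case: ifP => _; rewrite ?clamp_itv// M0 lexx.
Qed.

Lemma height_itv r M z : 0 <= M -> 0 <= height r M z <= M.
Proof.
case: z => [x|] M0 /=; last by rewrite M0 lexx.
by case: ifP => _; rewrite ?clamp_itv// lexx.
Qed.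

(** A depth of at most [|ln r|] can only fall to 0. A larger depth forces [|z| < r], where the
    modulus grows at most by the factor [A]. *)
Lemma depth_step (f : S -> S) A r M z : 1 <= A -> 0 < r -> 0 <= M ->
  f (origin R) = origin R ->
  (forall x, normC x < r ->
     exists2 y, f (Some x) = Some y & normC y <= A * normC x) ->
  depth M z - (ln A + `|ln r|) <= depth M (f z).
Proof.
move=> A1 r0 M0 f00 fA.
have lnA : 0 <= ln A by rewrite ln_ge0.
have c0 : 0 <= ln A + `|ln r| by rewrite addr_ge0.
have /andP[d0 _] := depth_itv (f z) M0.
have [/andP[zs _]|] := boolP ((depth M z <= `|ln r|) && true).
  by apply: le_trans d0; lra.
rewrite andbT -ltNge; case: z d0 => [x|] d0 /=; last by rewrite ltNge normr_ge0.
case: ifPn => [/eqP ->|x0].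
  by rewrite -/(origin R) f00 /= eqxx => _; lra.
have [xr|xr] := ltP (normC x) r; last first.
  have : clamp M (- ln (normC x)) <= `|ln r|.
    rewrite /clamp ge_max normr_ge0 ge_min /=; apply/orP; left.
    have : ln r <= ln (normC x) by rewrite ler_ln ?posrE ?cmod_gt0.
    by have := ler_norm (- ln r); rewrite normrN; lra.
  by move=> /le_lt_trans /[apply]; rewrite ltxx.
move=> _; have [y -> /=] := fA x xr.
case: ifPn => [_ _|y0 yA].
  by have /andP[_] := clamp_itv (- ln (normC x)) M0; lra.
apply: clamp_leB => //.
have : ln (normC y) <= ln (A * normC x).
  by rewrite ler_ln ?posrE ?mulr_gt0 ?cmod_gt0 ?(lt_le_trans ltr01).
rewrite lnM ?posrE ?cmod_gt0 ?(lt_le_trans ltr01)//.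
by have := normr_ge0 (ln r); lra.
Qed.

Lemma depth_pole (f : S -> S) A r M z : 1 <= A -> 1 <= r -> 0 <= M ->
  f (infty R) = origin R ->
  (forall x, r < normC x ->
     exists2 y, f (Some x) = Some y & normC x * normC y <= A) ->
  height r M z - ln A <= depth M (f z).
Proof.
move=> A1 r1 M0 foo fA; have lnA : 0 <= ln A by rewrite ln_ge0.
case: z => [x|] /=; last by rewrite -/(infty R) foo /= eqxx; lra.
case: ifPn => [rx|_]; last first.
  by have /andP[+ _] := depth_itv (f (Some x)) M0; lra.
have [y -> /=] := fA x rx.
have x0 : 0 < normC x by rewrite (lt_trans _ rx)// (lt_le_trans ltr01).
case: ifPn => [_ _|y0 yA].
  by have /andP[_] := clamp_itv (ln (normC x)) M0; lra.
apply: clamp_leB => //.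
have ny : 0 < normC y by rewrite cmod_gt0.
have A0 : 0 < A by rewrite (lt_le_trans ltr01).
have : ln (normC x * normC y) <= ln A by rewrite ler_ln ?posrE ?mulr_gt0.
by rewrite lnM ?posrE//; lra.
Qed.

(** The surplus [(d - delta) ln |x|] over the factor [delta] absorbs [ln a] as soon as [|x| > r].
    The truncation level is scaled by [delta] too, so that truncation does not spoil the growth. *)
Lemma height_step (f : S -> S) a r d delta M z : 0 < a -> 1 <= r -> 0 <= M ->
  1 <= delta -> - ln a <= (d%:R - delta) * ln r ->  delta <= d%:R ->
  f (infty R) = infty R ->
  (forall x, r < normC x -> f (Some x) = None \/
     exists2 y, f (Some x) = Some y & a * normC x ^+ d <= normC y) ->
  delta * height r M z <= height r (delta * M) (f z).
Proof.
move=> a0 r1 M0 de1 ar ded foo fa.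
have r0 : 0 < r by rewrite (lt_le_trans ltr01).
case: z => [x|] /=; last by rewrite -/(infty R) foo /=.
have dM0 : 0 <= delta * M by rewrite mulr_ge0// (le_trans ler01).
case: ifPn => [rx|_]; last first.
  by rewrite mulr0; case/andP: (height_itv r (f (Some x)) dM0).
have nx : 0 < normC x by rewrite (lt_trans _ rx).
have lr : 0 <= ln r by rewrite ln_ge0.
have lx : ln r < ln (normC x) by rewrite ltr_ln ?posrE.
have [->|[y -> /= ay]] := fa x rx.
  rewrite /= ler_pM2l; last by rewrite (lt_le_trans ltr01).
  by case/andP: (clamp_itv (ln (normC x)) M0).
have ny : 0 < normC y by rewrite (lt_le_trans _ ay)// mulr_gt0// exprn_gt0.
have ly : delta * ln (normC x) <= ln (normC y).
  have : ln (a * normC x ^+ d) <= ln (normC y).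
    by rewrite ler_ln ?posrE// mulr_gt0// exprn_gt0.
  rewrite lnM ?posrE ?exprn_gt0// lnXn// -mulr_natl.
  have : (d%:R - delta) * ln r <= (d%:R - delta) * ln (normC x).
    by rewrite ler_wpM2l ?subr_ge0// ltW.
  lra.
have -> : r < normC y.
  rewrite -ltr_ln ?posrE// (lt_le_trans lx)// (le_trans _ ly)//.
  by rewrite ler_peMl// (le_trans lr (ltW lx)).
have l0 : 0 <= ln (normC x) by rewrite (le_trans lr (ltW lx)).
have d0 : 0 <= delta by rewrite (le_trans ler01).
exact: clampZ.
Qed.

Variables (f0 f1 : S -> S) (p0 p1 : R) (d : nat).
Hypotheses (p0_gt0 : 0 < p0) (p1_gt0 : 0 < p1) (p01 : p0 + p1 = 1)
  (d_gt0 : (0 < d)%N) (p0d : d%:R^-1 < p0)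
  (f00 : f0 (origin R) = origin R) (f10 : f1 (origin R) = origin R)
  (f0oo : f0 (infty R) = infty R) (f1oo : f1 (infty R) = origin R).
Variables (A0 r0 A1 r1 A2 r2 a r3 : R).
Hypotheses (A0_ge1 : 1 <= A0) (r0_gt0 : 0 < r0)
  (f0A : forall x, normC x < r0 ->
     exists2 y, f0 (Some x) = Some y & normC y <= A0 * normC x)
  (A1_ge1 : 1 <= A1) (r1_gt0 : 0 < r1)
  (f1A : forall x, normC x < r1 ->
     exists2 y, f1 (Some x) = Some y & normC y <= A1 * normC x)
  (A2_ge1 : 1 <= A2)
  (f1_pole : forall x, r2 < normC x ->
     exists2 y, f1 (Some x) = Some y & normC x * normC y <= A2)
  (a_gt0 : 0 < a)
  (f0_infty : forall x, r3 < normC x -> f0 (Some x) = None \/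
     exists2 y, f0 (Some x) = Some y & a * normC x ^+ d <= normC y).

(* The height [ln |z|] near infinity is dominated by the drift of the depth
   [- ln |z|] near 0, and is expanded in mean by the factor [p0 * d > 1]. *)
Lemma mean_le0_far (e : R) : exists2 r : R, e <= r & mean_le0 f0 f1 p0 p1 \1_(far r).
Proof.
have p0_lt1 : p0 < 1 by rewrite -p01 ltrDl.
(* The midpoint of [1/p0] and [d]: then [p0 * delta > 1], while [delta < d] leaves room for the
   constant [a]. *)
pose delta := (p0^-1 + d%:R) / 2.
have p0V : p0^-1 < d%:R by rewrite invf_plt ?posrE ?ltr0n.
have p0V1 : 1 < p0^-1 by rewrite invf_gt1.
have de_lt : delta < d%:R by rewrite /delta; lra.
have de_gt : p0^-1 < delta by rewrite /delta; lra.
have de_gt1 : 1 < delta by lra.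
(* Beyond [r2] and [r3] the estimates at infinity hold; [expR 1] gives [ln r >= 1], and the last
   term gives [- ln a <= (d - delta) ln r]. *)
pose r : R := Num.max e (Num.max r2 (Num.max r3
  (Num.max (expR 1) (expR (`|ln a| / (d%:R - delta)))))).
have er : e <= r by rewrite /r le_max lexx.
have r2r : r2 <= r by rewrite /r !le_max lexx !orbT.
have r3r : r3 <= r by rewrite /r !le_max lexx !orbT.
have e1r : expR 1 <= r by rewrite /r !le_max lexx !orbT.
have ear : expR (`|ln a| / (d%:R - delta)) <= r by rewrite /r !le_max lexx !orbT.
have r_gt1 : 1 <= r by rewrite (le_trans _ e1r)//; have := expR_ge1Dx (1 : R); lra.
have r_gt0 : 0 < r by exact: lt_le_trans ltr01 r_gt1.
have lnr1 : 1 <= ln r by rewrite -[leLHS]expRK ler_ln ?posrE ?expR_gt0.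
exists r => //.
have h1 M : 0 <= M -> mean_le f0 f1 p0 p1 (height r M)
   ((ln A0 + `|ln r0| + ln A1 + `|ln r1| + ln A2) / p1).
  move=> M0; exists (fun z => p1^-1 * depth M z).
    exists (p1^-1 * M) => z; have /andP[q0 q1] := depth_itv z M0.
    have pV : 0 < p1^-1 by rewrite invr_gt0.
    by rewrite ger0_norm ?ler_pM2l// mulr_ge0// ltW.
  move=> z; rewrite -(ler_pM2l p1_gt0).
  have -> : p1 * ((ln A0 + `|ln r0| + ln A1 + `|ln r1| + ln A2) / p1 +
     (transfer f0 f1 p0 p1 (fun z => p1^-1 * depth M z) z - p1^-1 * depth M z)) =
     (ln A0 + `|ln r0| + ln A1 + `|ln r1| + ln A2) +
     (p0 * depth M (f0 z) + p1 * depth M (f1 z) - depth M z).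
    by rewrite /transfer; field; rewrite gt_eqF.
  have l0 : 0 <= ln A0 by rewrite ln_ge0.
  have l1 : 0 <= ln A1 by rewrite ln_ge0.
  have l2 : 0 <= ln A2 by rewrite ln_ge0.
  have n0 := normr_ge0 (ln r0); have n1 := normr_ge0 (ln r1).
  have p1E : p1 = 1 - p0 by rewrite -p01 addrAC subrr add0r.
  have p1_le1 : p1 <= 1 by rewrite -p01 lerDr ltW.
  have := ler_wpM2l (ltW p0_gt0) (depth_step z A0_ge1 r0_gt0 M0 f00 f0A).
  have := ler_wpM2l (ltW p1_gt0) (depth_step z A1_ge1 r1_gt0 M0 f10 f1A).
  have : height r M z - ln A2 <= depth M (f1 z).
    apply: depth_pole => // x rx; apply: f1_pole.
    exact: le_lt_trans rx.
  have [d0 _] := andP (depth_itv (f0 z) M0); have [d1 _] := andP (depth_itv (f1 z) M0).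
  (* Beyond [r] the depth is 0 and [f1] turns height into depth; elsewhere the height is 0 and the
     depth falls by a bounded amount. *)
  have [zf|zf] := pselect (far r z).
    have -> : depth M z = 0.
      clear d0 d1; case: z zf => [x|//] /= rx.
      have x1 : 0 < normC x by rewrite (lt_trans _ rx).
      rewrite -cmod_eq0 gt_eqF// /clamp; apply/max_idPl.
      by rewrite ge_min oppr_le0 ln_ge0// (le_trans r_gt1)// ltW.
    move=> h _ _; have := ler_wpM2l (ltW p1_gt0) h.
    have := mulr_ge0 (ltW p0_gt0) d0.
    have : p1 * ln A2 <= ln A2 by rewrite ler_piMl.
    lra.
  have -> : height r M z = 0.
    by clear d0 d1; case: z zf => [x|] //= /negP/negbTE ->.
  move=> _ h0' h1'.
  have : p1 * (ln A1 + `|ln r1|) <= ln A1 + `|ln r1|.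
    by rewrite ler_piMl ?addr_ge0.
  have : p0 * (ln A0 + `|ln r0|) <= ln A0 + `|ln r0|.
    by rewrite ler_piMl ?addr_ge0// ltW.
  by rewrite p1E in h0' *; lra.
have : mean_le0 f0 f1 p0 p1 (height r 1).
  apply: (mean_le0_growth (rho := p0 * delta) (delta := delta)) h1 _ _ _ => //.
  - by rewrite -ltr_pdivrMl// mulr1.
  - by rewrite ltW// (lt_trans ltr01).
  - by move=> M z M0; exact: height_itv.
  move=> M z M0; rewrite -mulrA /transfer.
  have dM0 : 0 <= delta * M by rewrite mulr_ge0// ltW// (lt_trans ltr01).
  apply: (@le_trans _ _ (p0 * height r (delta * M) (f0 z))); last first.
    have /andP[hh _] := height_itv r (f1 z) dM0.
    by rewrite lerDl; apply: mulr_ge0 => //; exact: ltW.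
  rewrite ler_pM2l//; apply: (@height_step f0 a r d) => //; try exact: ltW.
    rewrite mulrC -ler_pdivrMr ?subr_gt0//.
    apply: (@le_trans _ _ (`|ln a| / (d%:R - delta))).
      rewrite ler_pM2r ?invr_gt0 ?subr_gt0//.
      by rewrite -normrN ler_norm.
    by rewrite -[leLHS]expRK ler_ln ?posrE ?expR_gt0.
  by move=> x rx; apply: f0_infty; exact: le_lt_trans rx.
(* Since [ln r >= 1], the function [height r 1] equals 1 on [far r]. *)
apply: mean_le0_mono => z; rewrite indicE.
case: (boolP (z \in far r)) => [|_]; last by case/andP: (height_itv r z (@ler01 R)).
rewrite inE; case: z => [x|//] /= rx; rewrite rx /clamp le_max le_min lexx andbT.
apply/orP; right; rewrite (le_trans lnr1)// ler_ln ?posrE//; first exact: ltW.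
by rewrite (lt_trans _ rx).
Qed.

End Drift.

(** * Hitting times and stationary measures *)

Section HittingAndStationarity.
Local Open Scope complex_scope.
Context {R : realType}.
Local Notation C := R[i].
Local Notation S := (sphere R).
Local Notation normC := (@cmod R).
Variables (f0 f1 : S -> S).
Hypotheses (f0_cont : continuous f0) (f1_cont : continuous f1).
Implicit Types (z : S) (s : seq bool).

Lemma run_continuous s : continuous (run f0 f1 s).
Proof.
elim: s => [|b s IH] z; first exact: cvg_id.
have bc : {for z, continuous (step f0 f1 b)}.
  by case: b; [exact: f1_cont|exact: f0_cont].
exact: continuous_comp bc (IH _).
Qed.

Lemma run_cat s t z : run f0 f1 (s ++ t) z = run f0 f1 t (run f0 f1 s z).
Proof. by rewrite /run foldl_cat. Qed.

Lemma semigroup_run g : semigroup f0 f1 g -> exists s, g = run f0 f1 s.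
Proof.
elim=> [||g' h _ [s ->] _ [t ->]]; [by exists [:: false]|by exists [:: true]|].
by exists (t ++ s); apply/funext => z; rewrite run_cat.
Qed.

Lemma run_nseq_false k z : run f0 f1 (nseq k false) z = iter k f0 z.
Proof. by elim: k z => [//|k IH] z; rewrite iterSr -IH. Qed.

(** Each point off the ball reaches the basin by some word and then [far r] by iterating [f0];
    infinity needs only the empty word. These open conditions cover a compact set. *)
Lemma finite_hitting (r e : R) : 0 < e ->
  (forall z, z <> origin R -> z <> infty R -> exists2 g,
     semigroup f0 f1 g & immediate_basin_infty f0 (g z)) ->
  exists ws : seq (seq bool), forall z, ~ sphere_ball e z ->
    exists2 s, s \in ws & far r (run f0 f1 s z).
Proof.
move=> e0 reach.
have cptK : compact (~` sphere_ball e : set S).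
  apply: subclosed_compact (one_point_compactification_compact) _ => //.
  by apply: open_closedC; exact: open_sphere_ball.
move: cptK; rewrite compact_cover => /(_ (seq bool) setT
  (fun s => run f0 f1 s @^-1` far r)) [].
- move=> s _; apply: open_comp; last exact: open_far.
  by move=> z _; exact: run_continuous.
- move=> z /= nz.
  have z0 : z <> origin R.
    by move=> zE; apply: nz; rewrite zE; exists 0; rewrite // ComplexField.Normc.normc0.
  have [zoo|zoo] := pselect (z = infty R); first by exists [::] => //=; rewrite zoo.
  have [g /semigroup_run[s ->] /connected_component_sub bas] := reach z z0 zoo.
  have /bas[n _ /(_ n)] : nbhs (infty R) (far r) by apply/nbhs_infty; exists r.
  rewrite /= leqnn => /(_ isT) fn.
  by exists (s ++ nseq n false) => //=; rewrite run_cat run_nseq_false.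
move=> D _ cD; exists (enum_fset D) => z /cD[s /= sD fs].
by exists s.
Qed.

Variables (p0 p1 : R).
Hypotheses (p0_gt0 : 0 < p0) (p1_gt0 : 0 < p1) (p01 : p0 + p1 = 1).

Section WordMeanIntegral.
Variables (d : measure_display) (T : measurableType d) (m : probability T R).

(** Measurability and positivity are carried along because additivity of the integral needs them at
    each induction step. *)
Lemma integral_word_mean n (B : seq bool -> set T) :
  (forall s, measurable (B s)) ->
  [/\ measurable_fun setT (fun x => word_mean p0 p1 n (fun s => \1_(B s) x)),
      forall x, 0 <= word_mean p0 p1 n (fun s => \1_(B s) x) &
      (\int[m]_x (word_mean p0 p1 n (fun s => \1_(B s) x))%:E)%E =
      (word_mean p0 p1 n (fun s => fine (m (B s))))%:E].
Proof.
elim: n B => [|n IH] B mB /=.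
  split; first exact: measurable_indic.
    by move=> x; rewrite indicE.
  by rewrite integral_indic// setIT fineK// fin_num_measure.
have [m0 g0 e0] := IH (fun s => B (false :: s)) (fun s => mB _).
have [m1 g1 e1] := IH (fun s => B (true :: s)) (fun s => mB _).
split.
- by apply: measurable_funD; apply: measurable_funM => //; exact: measurable_cst.
- by move=> x; rewrite addr_ge0// mulr_ge0// ltW.
under eq_integral do rewrite EFinD !EFinM.
rewrite ge0_integralD//=.
- rewrite !ge0_integralZl_EFin ?e0 ?e1 ?ltW//.
  + by move=> x _; rewrite lee_fin.
  + exact/measurable_EFinP.
  + by move=> x _; rewrite lee_fin.
  + exact/measurable_EFinP.
- by move=> x _; rewrite -EFinM lee_fin mulr_ge0// ltW.
- by apply: measurable_funeM; exact/measurable_EFinP.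
- by move=> x _; rewrite -EFinM lee_fin mulr_ge0// ltW.
- by apply: measurable_funeM; exact/measurable_EFinP.
Qed.

End WordMeanIntegral.

Lemma closed_measurable_borel (K : set S) : closed K ->
  measurable (K : set (borel S)).
Proof.
move=> cK; rewrite -(setCK K); apply: measurableC; apply: sub_sigma_algebra.
exact: closed_openC.
Qed.

Lemma open_measurable_borel (K : set S) : open K -> measurable (K : set (borel S)).
Proof. by move=> oK; exact: sub_sigma_algebra. Qed.

(** By stationarity every iterate of [transfer] on the indicator of [K] has integral [m K].
    Integrating the telescoped sum of [N] iterates gives [N m(K) <= N c/2 + 2b], hence [m K <= c]
    for large [N]. *)
Lemma stationary_mean_le0 (m : probability (borel S) R) (K : set S) :
  stationary p0 p1 f0 f1 m -> closed K -> mean_le0 f0 f1 p0 p1 \1_K -> m K = 0.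
Proof.
move=> stm cK HK.
pose B s : set (borel S) := run f0 f1 s @^-1` K.
have mB s : measurable (B s).
  apply: closed_measurable_borel; apply: closed_comp cK => z _.
  exact: run_continuous.
have wm n : word_mean p0 p1 n (fun s => fine (m (B s))) = fine (m (B [::])).
  have rec s : fine (m (B s)) = p0 * fine (m (B (false :: s))) + p1 * fine (m (B (true :: s))).
    have := stm _ (mB s); rewrite /pushforward => e.
    apply: EFin_inj; rewrite EFinD !EFinM !fineK ?fin_num_measure//.
  elim: n => [//|n IH] /=; rewrite -!word_meanZ -word_meanD -[RHS]IH.
  by congr word_mean; apply/funext => s; rewrite -rec.
apply/eqP; rewrite eq_le measure_ge0 andbT.
have mKE : m K = (fine (m (B [::])))%:E by rewrite fineK// fin_num_measure.
rewrite mKE lee_fin; apply/ler_addgt0Pl => c c0; rewrite addr0.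
have [phi [b phib] Hphi] := HK (c / 2) (divr_gt0 c0 (ltr0n _ 2)).
have b0 : 0 <= b by rewrite (le_trans _ (phib (origin R))).
have bound N : fine (m (B [::])) * N%:R <= c / 2 * N%:R + 2 * b.
  pose g i z := word_mean p0 p1 i (fun s => \1_(B s) z : R).
  have [mg g0 ig] : [/\ forall i, measurable_fun setT (g i : borel S -> R),
      forall i z, 0 <= g i z &
      forall i, (\int[m]_z (g i z)%:E)%E = (fine (m (B [::])))%:E].
    by split=> i; have [h1 h2 h3] := @integral_word_mean _ _ m i B mB;
      [exact: h1|exact: h2|rewrite -(wm i) -h3].
  have gE i z : g i z = iter i (transfer f0 f1 p0 p1) \1_K z by rewrite -word_mean_run.
  have gs z : \sum_(i < N) g i z <= c / 2 * N%:R + 2 * b.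
    under eq_bigr do rewrite gE.
    apply: (le_trans (iter_transfer_sum p0_gt0 p1_gt0 p01 N Hphi z)).
    rewrite mulr_natr lerD2l.
    have := @norm_iter_transfer _ _ f0 f1 p0 p1 p0_gt0 p1_gt0 p01 N phi b z phib.
    have := phib z.
    by rewrite !ler_norml => /andP[? ?] /andP[? ?]; lra.
  rewrite -lee_fin mulr_natr.
  have -> : (fine (m (B [::])) *+ N)%:E = (\int[m]_z (\sum_(i < N) g i z)%:E)%E.
    under eq_integral do rewrite -sumEFin.
    rewrite ge0_integral_sum//.
    - rewrite (eq_bigr (fun=> (fine (m (B [::])))%:E)); last by move=> i _; exact: ig.
      by rewrite sumEFin sumr_const card_ord.
    - by move=> i; apply/measurable_EFinP; exact: mg.
    - by move=> i z _; rewrite lee_fin.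
  have -> : (c / 2 * N%:R + 2 * b)%:E = (\int[m]_(z in setT) cst (c / 2 * N%:R + 2 * b)%:E z)%E.
    rewrite integral_cst// [X in (_ * X)%E](_ : _ = 1%E) ?mule1//.
    exact: probability_setT.
  apply: ge0_le_integral => //.
  - by move=> z _; rewrite lee_fin sumr_ge0.
  - by apply/measurable_EFinP; apply: measurable_sum => i; exact: mg.
  - by move=> z _; rewrite lee_fin.
have [N bN] : exists N : nat, 2 * b <= c / 2 * N.+1%:R.
  exists (Num.truncn ((c / 2)^-1 * (2 * b))); rewrite -ler_pdivrMl ?divr_gt0//.
  by apply: ltW; exact: truncnS_gt.
have := bound N.+1; have : 0 < N.+1%:R :> R by [].
move: (N.+1%:R : R) bN => x bN x0 h.
by rewrite -(ler_pM2r x0); lra.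
Qed.

(** A stationary probability gives mass 0 to the complements of the balls of radius [1/(k+1)], whose
    union is everything but the origin. Conversely, preimages under [f0] and [f1] preserve
    membership of the fixed origin. *)
Lemma stationary_dirac0 (m : probability (borel S) R) :
  f0 (origin R) = origin R -> f1 (origin R) = origin R ->
  (forall e : R, 0 < e -> mean_le0 f0 f1 p0 p1 \1_(~` sphere_ball e)) ->
  stationary p0 p1 f0 f1 m <->
  (forall A : set (borel S), measurable A -> m A = \d_(origin R : borel S) A).
Proof.
move=> f00 f10 H; split=> [stm|mE]; last first.
  move=> A mA; have mf b : measurable (step f0 f1 b @^-1` A : set (borel S)).
    suff : measurable_fun setT (step f0 f1 b : borel S -> borel S).
      by move=> /(_ measurableT A mA); rewrite setTI.
    apply: (@measurability _ _ (borel S) (borel S) setT (step f0 f1 b) (@open S)) => //.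
    move=> _ [U oU <-]; rewrite setTI; apply: open_measurable_borel.
    apply: open_comp oU => z _.
    by case: b; [exact: f1_cont|exact: f0_cont].
  have pre b : ((origin R : borel S) \in (step f0 f1 b @^-1` A : set (borel S))) =
      ((origin R : borel S) \in A).
    by apply/idP/idP; rewrite !inE /preimage /=; case: b; rewrite /step ?f00 ?f10.
  rewrite /pushforward (mE _ mA) (mE _ (mf false)) (mE _ (mf true)) !diracE !pre.
  by rewrite -!EFinM -EFinD -mulrDl p01 mul1r.
pose Z : set (borel S) := ~` [set origin R].
have ZE : Z = \bigcup_k (~` sphere_ball k.+1%:R^-1).
  apply/seteqP; split=> [z z0|z [k _ /= nb] zE]; last first.
    by apply: nb; rewrite zE; exists 0; rewrite // ComplexField.Normc.normc0.
  case: z z0 => [x|] z0; last by exists 0%N => // -[].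
  have x0 : 0 < normC x by rewrite cmod_gt0; apply/eqP => x0; apply: z0; rewrite x0.
  exists (Num.truncn (normC x)^-1) => //= -[y [<-]]; apply/negP; rewrite -leNgt.
  by rewrite invf_ple ?posrE//; apply: ltW; exact: truncnS_gt.
have mb k : measurable ((~` sphere_ball k.+1%:R^-1 : set S) : set (borel S)).
  by apply: closed_measurable_borel; apply: open_closedC; exact: open_sphere_ball.
have mZ : measurable Z by rewrite ZE; exact: bigcupT_measurable.
have Z0 : m Z = 0.
  apply: (@measure_negligible _ _ _ m) => //; rewrite ZE.
  apply: negligible_bigcup => k; exists (~` sphere_ball k.+1%:R^-1); split => //.
  apply: stationary_mean_le0 => //.
    by apply: open_closedC; exact: open_sphere_ball.
  by apply: H; rewrite invr_gt0.
move=> A mA; rewrite diracE; have [A0|/negP A0] := boolP (_ \in A); last first.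
  apply: (subset_measure0 mA mZ) => // z Az /= z0.
  by apply: A0; rewrite inE -z0.
rewrite -(setCK A) probability_setC; last exact: measurableC.
rewrite (_ : m (~` A) = 0) ?sube0//.
apply: (subset_measure0 (measurableC mA) mZ) => // z nAz /= z0.
by apply: nAz; rewrite z0; rewrite inE in A0.
Qed.

End HittingAndStationarity.

(** * Expansion at 0 *)

Section Fibers.
Local Open Scope complex_scope.
Context {R : realType}.
Local Notation C := R[i].
Local Notation S := (sphere R).
Local Notation normC := (@cmod R).
Implicit Types (x y : C) (z v : S).

Lemma finite_roots (p : {poly C}) : p != 0 -> finite_set [set x | root p x].
Proof.
move=> p0; have [rs pE] := closed_field_poly_normal p.
apply: (@sub_finite_set _ _ [set` rs]); last exact: finite_seq.
move=> x /=; rewrite pE rootZ ?lead_coef_eq0// root_prod_XsubC.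
exact.
Qed.

(** Finite fibers amount to [f] not being constant, which [rational_map] alone allows: a constant
    would be [f 0 = 0], against the lower bound at the point [r / 2]. *)
Lemma finite_fiber (f : S -> S) (kappa r : R) v : rational_map f ->
  f (origin R) = origin R -> 0 < kappa -> 0 < r ->
  (forall x, normC x < r -> exists2 y, f (Some x) = Some y & kappa * normC x <= normC y) ->
  finite_set (f @^-1` [set v]).
Proof.
move=> [n [p [q [_ _ fE]]]] f0 k0 r0 fk.
have q0 : q.[0] != 0.
  by apply/negP => q0; move: f0; rewrite fE /origin /= q0.
have p0 : p.[0] = 0.
  move: f0; rewrite fE /origin /= (negbTE q0) => -[] /eqP.
  by rewrite mulf_eq0 invr_eq0 (negbTE q0) orbF => /eqP.
have qn : q != 0 by apply/negP => /eqP q00; move: q0; rewrite q00 horner0 eqxx.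
have pcn c : p - c *: q != 0.
  apply/negP; rewrite subr_eq0 => /eqP pE.
  have c0 : c = 0.
    move: p0; rewrite pE hornerZ => /eqP; rewrite mulf_eq0 (negbTE q0) orbF.
    by move/eqP.
  have pz : p = 0 by rewrite pE c0 scale0r.
  pose w : C := (r / 2)%:C.
  have xr : normC w = r / 2.
    by rewrite /= expr0n addr0 sqrtr_sqr ger0_norm// divr_ge0// ltW.
  have [|y] := fk w; first by rewrite xr; lra.
  rewrite fE {1}/ratmap pz horner0 mul0r; case: ifP => // _ [<-].
  by rewrite xr ComplexField.Normc.normc0 leNgt mulr_gt0// divr_gt0.
have fin : finite_set [set x | f (Some x) = v].
  case: v => [c|]; last first.
    apply: sub_finite_set (finite_roots qn) => x /=; rewrite fE /=.
    by case: ifP => // /eqP qx _; rewrite rootE qx.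
  apply: sub_finite_set (finite_roots (pcn c)) => x /=; rewrite fE /=.
  case: ifPn => // qx [pq]; by rewrite rootE !hornerE -pq divfK ?subrr.
apply: (@sub_finite_set _ _ ([set infty R] `|` Some @` [set x | f (Some x) = v])).
  by move=> [x|] /= fx; [right; exists x|left].
by rewrite finite_setU; split; [exact: finite_set1|exact: finite_image].
Qed.

Variables (f0 f1 : S -> S).
Hypotheses (fib0 : forall v, finite_set (f0 @^-1` [set v]))
           (fib1 : forall v, finite_set (f1 @^-1` [set v])).

Lemma countable_preorbit v : countable [set z | exists s, run f0 f1 s z = v].
Proof.
have -> : [set z | exists s, run f0 f1 s z = v] =
    \bigcup_(s in [set: seq bool]) [set z | run f0 f1 s z = v].
  by apply/seteqP; split=> z [s]; [exists s|move=> _ /= <-; exists s].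
apply: bigcup_countable; first exact: countableP.
move=> s _; elim: s => [|b s IH]; first exact: countable1.
have -> : [set z | run f0 f1 (b :: s) z = v] =
    \bigcup_(u in [set z | run f0 f1 s z = v]) (step f0 f1 b @^-1` [set u]).
  by apply/seteqP; split=> z /=; [exists (step f0 f1 b z)|case=> u /= <- <-].
apply: bigcup_countable => // u _; apply: finite_set_countable.
by case: b; [exact: fib1|exact: fib0].
Qed.

Lemma countable_sphere_ae (E : set S) : countable E -> sphere_ae (fun z => ~ E z).
Proof.
move=> cE.
(* The set is covered by countably many vertical lines, one for each real part. *)
pose D := (fun z : S => complex.Re (sphere_coord z)) @` E.
have cD : countable D by apply: card_le_trans cE; exact: card_image_le.
have mD : measurable D by apply: countable_measurable => // t; exact: measurable_set1.
exists (D `*` setT); split.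
- exact: measurableX.
- rewrite product_measure1E// [X in (X * _)%E](_ : _ = 0%E) ?mul0e//.
  exact: countable_lebesgue_measure0.
move=> [x y] /= /contrapT Exy; split => //=; exists (Some (x +i* y)) => //.
Qed.

End Fibers.

(** * A Lyapunov function at the origin *)

Section Lyapunov.
Local Open Scope complex_scope.
Context {R : realType}.
Local Notation C := R[i].
Local Notation S := (sphere R).
Local Notation normC := (@cmod R).

(* With [a] and [b] the logarithms of the expansion factors at 0, this makes
   [|z| ^ (- t)] contract in mean. *)
Lemma contracting_exponent (p0 p1 a b : R) : 0 < p0 -> 0 < p1 -> p0 + p1 = 1 ->
  0 < p0 * a + p1 * b ->
  exists2 t, 0 < t & p0 * expR (- (t * a)) + p1 * expR (- (t * b)) < 1.
Proof.
move=> p0_gt0 p1_gt0 p01; set L := p0 * a + p1 * b => L0.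
pose K := 1 + `|a| + `|b|.
have K1 : 1 <= K by rewrite /K -addrA lerDl addr_ge0.
have K0 : 0 < K by rewrite (lt_le_trans ltr01).
(* Again [t] keeps exponents at most 1/2, and makes the quadratic error [2 t^2 K^2] at most half of
   the linear gain [t L]. *)
pose t := Num.min (2 * K)^-1 (L / (4 * K ^+ 2)).
have t0 : 0 < t by rewrite lt_min invr_gt0 divr_gt0 ?mulr_gt0 ?exprn_gt0.
have tK : t * K <= 2^-1.
  by rewrite -ler_pdivlMr// -invfM ge_min lexx.
have tK2 : 4 * t * K ^+ 2 <= L.
  have : t <= L / (4 * K ^+ 2) by rewrite ge_min lexx orbT.
  by rewrite ler_pdivlMr ?mulr_gt0 ?exprn_gt0//; lra.
have e c : `|c| <= K -> expR (- (t * c)) <= 1 - t * c + 2 * t ^+ 2 * K ^+ 2.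
  move=> cK; move: (cK); rewrite ler_norml => /andP[c1 c2].
  have /expR_le_quadratic/le_trans : - (t * c) <= 2^-1.
    have : t * (- K) <= t * c by rewrite ler_pM2l.
    lra.
  apply; rewrite sqrrN exprMn.
  have : c ^+ 2 <= K ^+ 2 by rewrite -subr_ge0 subr_sqr mulr_ge0; lra.
  move/(ler_wpM2l (ltW (mulr_gt0 (ltr0n _ 2) (exprn_gt0 2 t0)))); lra.
exists t => //.
have ea := e a _; have eb := e b _.
have {}ea := ea ltac:(by rewrite /K; have := normr_ge0 b; lra).
have {}eb := eb ltac:(by rewrite /K; have := normr_ge0 a; lra).
have := lerD (ler_wpM2l (ltW p0_gt0) ea) (ler_wpM2l (ltW p1_gt0) eb).
move=> /le_lt_trans; apply.
have -> : p0 * (1 - t * a + 2 * t ^+ 2 * K ^+ 2) + p1 * (1 - t * b + 2 * t ^+ 2 * K ^+ 2)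
    = (p0 + p1) * (1 + 2 * t ^+ 2 * K ^+ 2) - t * L by rewrite /L; ring.
rewrite p01 mul1r.
have := ler_wpM2l (ltW t0) tK2; have : 0 < t * L by rewrite mulr_gt0.
rewrite !expr2; lra.
Qed.

(** This is [(|z| / r)^(-t)], scaled to be at least 1 on the punctured ball of radius [r]. The value
    at infinity is the limit; the value at 0 is a default, and the orbits considered avoid 0. *)
Definition lyapunov (t r : R) (z : S) : R :=
  if z is Some x then if x == 0 then 0 else expR (- (t * (ln (normC x) - ln r))) else 0.

Lemma lyapunov_ge0 t r z : 0 <= lyapunov t r z.
Proof. by case: z => [x|] //=; case: ifP => _ //; exact: expR_ge0. Qed.

Lemma lyapunov_ge1 t r z : 0 < t -> 0 < r -> z <> origin R -> sphere_ball r z ->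
  1 <= lyapunov t r z.
Proof.
move=> t0 r0 z0 [x zE xr]; rewrite zE in z0 *; rewrite /=.
have x0 : x != 0 by apply/eqP => x0; apply: z0; rewrite x0.
rewrite (negbTE x0) -expR0 ler_expR oppr_ge0 pmulr_rle0// subr_le0.
by rewrite ler_ln ?posrE ?cmod_gt0// ltW.
Qed.

Lemma lyapunov_step t r kappa x y : 0 < t -> 0 < kappa -> x != 0 ->
  kappa * normC x <= normC y ->
  lyapunov t r (Some y) <= expR (- (t * ln kappa)) * lyapunov t r (Some x).
Proof.
move=> t0 k0 x0 kxy.
have nx : 0 < normC x by rewrite cmod_gt0.
have ny : 0 < normC y by rewrite (lt_le_trans _ kxy)// mulr_gt0.
have y0 : y != 0 by rewrite -cmod_gt0.
rewrite /= (negbTE x0) (negbTE y0) -expRD ler_expR.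
have : ln (kappa * normC x) <= ln (normC y) by rewrite ler_ln ?posrE ?mulr_gt0.
rewrite lnM ?posrE// -(ler_pM2l t0); lra.
Qed.

Lemma lyapunov_transfer (f0 f1 : S -> S) (p0 p1 k0 k1 r t : R) z :
  0 < p0 -> 0 < p1 -> 0 < k0 -> 0 < k1 -> 0 < t ->
  (forall x, normC x < r -> exists2 y, f0 (Some x) = Some y & k0 * normC x <= normC y) ->
  (forall x, normC x < r -> exists2 y, f1 (Some x) = Some y & k1 * normC x <= normC y) ->
  z <> origin R -> sphere_ball r z ->
  transfer f0 f1 p0 p1 (lyapunov t r) z <=
  (p0 * expR (- (t * ln k0)) + p1 * expR (- (t * ln k1))) * lyapunov t r z.
Proof.
move=> p0_gt0 p1_gt0 k00 k10 t0 H0 H1 z0 [x zE xr]; rewrite zE in z0 *.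
have x0 : x != 0 by apply/eqP => x0; apply: z0; rewrite x0.
have [y0 f0x y0k] := H0 x xr; have [y1 f1x y1k] := H1 x xr.
rewrite /transfer f0x f1x mulrDl -!mulrA; apply: lerD.
  by rewrite ler_pM2l//; exact: lyapunov_step.
by rewrite ler_pM2l//; exact: lyapunov_step.
Qed.

End Lyapunov.

Theorem theorem2p7 (R : realType) (f0 f1 : R[i] -> sphere R -> sphere R)
  (p0 p1 : R) (d : nat) (mu nu : R[i] -> R[i])
  (f0_rational : forall l : R[i], `|l| < 1 -> rational_map (f0 l))
  (f1_rational : forall l : R[i], `|l| < 1 -> rational_map (f1 l))
  (f0_analytic : analytic_family f0)
  (f1_analytic : analytic_family f1)
  (p0_itv : 0 < p0 < 1) (p1_itv : 0 < p1 < 1) (p01 : p0 + p1 = 1)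
  (muE : forall l : R[i], `|l| < 1 -> mu l = sphere_deriv (f0 l) (origin R))
  (nuE : forall l : R[i], `|l| < 1 -> nu l = sphere_deriv (f1 l) (origin R))
  (hyp_a : forall l : R[i], `|l| < 1 ->
    [/\ f0 l (origin R) = origin R, f1 l (origin R) = origin R,
        1 < `|mu l| & `|nu l| < 1])
  (d_ge2 : (2 <= d)%N)
  (hyp_b : forall l : R[i], `|l| < 1 ->
    [/\ superattracting_fixed (f0 l) (infty R),
        has_local_degree (f0 l) (infty R) d
      & f1 l (infty R) = origin R])
  (hyp_c : forall l : R[i], `|l| < 1 ->
    hyperbolic (f0 l) /\
    forall a : sphere R, attracting_periodic (f0 l) a -> a <> infty R ->
      exists2 k, (0 < k)%N & immediate_basin_infty (f0 l) (iter k (f1 l) a))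
  (hyp_d : forall l : R[i], `|l| < 1 ->
    (0 < p0%:E * lne (cmod (mu l))%:E + p1%:E * lne (cmod (nu l))%:E)%E)
  (lambda : R[i]) (lambda_disc : `|lambda| < 1)
  (hyp_e : closure [set x : R[i] |
      exists n m : nat, x = mu lambda ^+ n * nu lambda ^+ m] = setT)
  (hyp_f : forall a : sphere R, attracting_periodic (f0 lambda) a ->
    forall k, (0 < k)%N -> iter k (f1 lambda) a <> infty R)
  (hyp_g : forall z0 : sphere R, z0 <> origin R -> z0 <> infty R ->
    exists2 g : sphere R -> sphere R,
      semigroup (f0 lambda) (f1 lambda) g &
      immediate_basin_infty (f0 lambda) (g z0))
  (p0_gt : d%:R^-1 < p0) :
  (forall m : probability (borel (sphere R)) R,
     stationary p0 p1 (f0 lambda) (f1 lambda) m <->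
     (forall A : set (borel (sphere R)), measurable A ->
        m A = \d_(origin R : borel (sphere R)) A))
  /\
  (forall nup : probability (borel cantor_space) R,
     bernoulli_measure p0 p1 nup ->
     forall e : R, 0 < e ->
     sphere_ae (fun z =>
       {ae nup, forall w : cantor_space,
         (forall N : nat, exists2 n, (N <= n)%N &
            ~ sphere_ball e (random_orbit (f0 lambda) (f1 lambda) w n z)) /\
         ((visits (f0 lambda) (f1 lambda) w z (sphere_ball e) N)%:R / N%:R : R)
            @[N --> \oo] --> (1 : R)})).
Proof.
have /andP[p0_gt0 _] := p0_itv; have /andP[p1_gt0 _] := p1_itv.
have [f00 f10 mu1 _] := hyp_a lambda lambda_disc.
have [[f0oo _] f0deg f1oo] := hyp_b lambda lambda_disc.
have c0 := analytic_family_continuous f0_analytic lambda_disc.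
have c1 := analytic_family_continuous f1_analytic lambda_disc.
have m0 : 0 < cmod (mu lambda).
  by rewrite cmod_gt0 -normr_gt0 (lt_trans ltr01).
(* Positivity in [hyp_d] forces [nu lambda] to be nonzero, as otherwise the sum would be minus
   infinity. *)
have [m1 L0] : 0 < cmod (nu lambda) /\
    0 < p0 * ln (cmod (mu lambda)) + p1 * ln (cmod (nu lambda)).
  have := hyp_d lambda lambda_disc; rewrite (lne_EFin m0).
  have [nu0|nu0] := ltP 0 (cmod (nu lambda)); first by rewrite (lne_EFin nu0).
  by rewrite le0_lneNy ?lee_fin// gt0_muleNy ?lte_fin.
set L := _ + _ in L0.
(* Each factor gives up [L / 2] in its logarithm: both lie strictly below the multipliers, yet
   [p0 ln k0 + p1 ln k1 = L / 2] is still positive. *)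
pose k0 := cmod (mu lambda) * expR (- (L / 2)).
pose k1 := cmod (nu lambda) * expR (- (L / 2)).
have e1 : expR (- (L / 2)) < 1 by rewrite expR_lt1 oppr_lt0 divr_gt0.
have k0_gt0 : 0 < k0 by rewrite mulr_gt0// expR_gt0.
have k1_gt0 : 0 < k1 by rewrite mulr_gt0// expR_gt0.
have [A0 [r0 [A01 r0_gt0 H0]]] : exists A r : R, [/\ 1 <= A, 0 < r & forall x, cmod x < r ->
    exists2 y, f0 lambda (Some x) = Some y & k0 * cmod x <= cmod y <= A * cmod x].
  apply: origin_estimate => //; rewrite -muE// (ltW k0_gt0)/=.
  by rewrite /k0 gtr_pMr.
have [A1 [r1 [A11 r1_gt0 H1]]] : exists A r : R, [/\ 1 <= A, 0 < r & forall x, cmod x < r ->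
    exists2 y, f1 lambda (Some x) = Some y & k1 * cmod x <= cmod y <= A * cmod x].
  apply: origin_estimate => //; rewrite -nuE// (ltW k1_gt0)/=.
  by rewrite /k1 gtr_pMr.
have [A2 [r2 [A21 r2_gt0 H2]]] := pole_estimate f1_analytic lambda_disc f1oo.
have [a [r3 [a_gt0 r3_gt0 H3]]] := infty_estimate f0oo f0deg.
have far_null e : exists2 r : R, e <= r & mean_le0 (f0 lambda) (f1 lambda) p0 p1 \1_(far r).
  have H0' x : cmod x < r0 -> exists2 y, f0 lambda (Some x) = Some y & cmod y <= A0 * cmod x.
    by move=> /H0[y fy /andP[_ yA]]; exists y.
  have H1' x : cmod x < r1 -> exists2 y, f1 lambda (Some x) = Some y & cmod y <= A1 * cmod x.
    by move=> /H1[y fy /andP[_ yA]]; exists y.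
  exact: (mean_le0_far p0_gt0 p1_gt0 p01 (ltnW d_ge2) p0_gt f00 f10 f0oo f1oo
    A01 r0_gt0 H0' A11 r1_gt0 H1' A21 H2 a_gt0 H3).
have ball_null e : 0 < e ->
    mean_le0 (f0 lambda) (f1 lambda) p0 p1 \1_(~` sphere_ball e).
  move=> e0; have [r _ rn] := far_null 0.
  have [ws hit] := finite_hitting c0 c1 r e0 hyp_g.
  exact: (mean_le0_cover p0_gt0 p1_gt0 rn hit).
split=> [m|nup nupE e e0]; first exact: (stationary_dirac0 c0 c1 p0_gt0 p1_gt0 p01 m f00 f10 ball_null).
pose r := Num.min r0 r1.
have r_gt0 : 0 < r by rewrite lt_min r0_gt0.
have K0 x : cmod x < r -> exists2 y, f0 lambda (Some x) = Some y & k0 * cmod x <= cmod y.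
  by rewrite lt_min => /andP[/H0[y fy /andP[yk _]] _]; exists y.
have K1 x : cmod x < r -> exists2 y, f1 lambda (Some x) = Some y & k1 * cmod x <= cmod y.
  by rewrite lt_min => /andP[_ /H1[y fy /andP[yk _]]]; exists y.
have Lk : 0 < p0 * ln k0 + p1 * ln k1.
  rewrite /k0 /k1 !lnM ?posrE ?expR_gt0// !expRK.
  have -> : p0 * (ln (cmod (mu lambda)) - L / 2) + p1 * (ln (cmod (nu lambda)) - L / 2)
      = L - (p0 + p1) * (L / 2) by rewrite /L; ring.
  by rewrite p01; lra.
have [t t0 tk] := contracting_exponent p0_gt0 p1_gt0 p01 Lk.
(* With [e <= q], reaching [far q] means being outside the ball of radius [e]. *)
have [q eq qn] := far_null e.
have [ws hit] := finite_hitting c0 c1 q r_gt0 hyp_g.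
(* The exceptional initial points; the complement of [E] is forward invariant and avoids the
   origin. *)
pose E := [set z | exists s, run (f0 lambda) (f1 lambda) s z = origin R].
have cE : countable E.
  apply: countable_preorbit => v.
    exact: (finite_fiber v (f0_rational lambda lambda_disc) f00 k0_gt0 r_gt0 K0).
  exact: (finite_fiber v (f1_rational lambda lambda_disc) f10 k1_gt0 r_gt0 K1).
have [D [mD D0 DE]] := countable_sphere_ae cE.
exists D; split => //; apply: subset_trans DE; apply: subsetC => -[x y] /= nE.
have leaves : {ae nup, forall w : cantor_space, forall N : nat, exists2 n, (N <= n)%N &
    ~ sphere_ball e (random_orbit (f0 lambda) (f1 lambda) w n (Some (x +i* y)%C))}.
  (* Two balls occur: the Lyapunov function contracts on the ball of radius [r], and the ball of
     radius [e] is the one to be left. *)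
  apply: (@random_orbit_leaves _ p0 p1 nup p0_gt0 p1_gt0 p01 nupE (f0 lambda) (f1 lambda)
    (~` E) (sphere_ball r) (sphere_ball e) ws (lyapunov t r)
    (p0 * expR (- (t * ln k0)) + p1 * expR (- (t * ln k1)))) => //.
  - by move=> b z nEz [s sz]; apply: nEz; exists (b :: s).
  - by move=> z; exact: lyapunov_ge0.
  - move=> z nEz zr; apply: lyapunov_ge1 => // z0.
    by apply: nEz; exists [::].
  - by rewrite tk andbT addr_ge0// mulr_ge0// ?expR_ge0// ltW.
  - move=> z nEz zr; apply: lyapunov_transfer => // z0.
    by apply: nEz; exists [::].
  - move=> z _ /hit[s sws sf]; exists s => // -[u uE ue].
    by move: sf; rewrite uE /= ltNge (le_trans (ltW ue) eq).
have freq := visits_cvg p0_gt0 p1_gt0 p01 nupE (Some (x +i* y)%C) (ball_null e e0).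
apply: negligibleS (negligibleU leaves freq) => w /= /not_andP[nw|nw]; [by left|by right].
Qed.
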